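(* Let $m=1$ and $1<p<N$. Let $\mathcal{X}$ be an admissible function space such that for any $u\in\mathcal{X}$ and any $t\ge0$, $s\le0$, one has $\min(u,t)\in\mathcal{X}$ and $\max(u,s)\in\mathcal{X}$. Assume that $$T:=\inf\{J(u)\;|\;u\in\mathcal{X},\ V(u)=1\}>0$$ and that the problem of minimizing $J(u)$ in the set $\{u\in\mathcal{X}\;|\;V(u)=1\}$ has a minimizer $u_*\in\mathcal{X}$. If, for some $\lambda>0$, $u\in\mathcal{X}$ is a minimizer of $J$ in the set $\{v\in\mathcal{X}\;|\;V(v)=\lambda\}$, then $u$ does not change sign.
   Context: Setting (scalar case): $1<p<\infty$, $g:\mathbf{R}\to\mathbf{R}$ with $g(0)=0$, and there is $G\in C^1(\mathbf{R}\setminus\{0\},\mathbf{R})\cap C(\mathbf{R},\mathbf{R})$ such that $g(s)=G'(s)$ for $s\ne0$. Functions $u$ are real-valued on $\mathbf{R}^N$; gradients are weak gradients. Notation: for $\sigma>0$, $f_\sigma(x)=f(x/\sigma)$. For an affine hyperplane $\Pi$ in $\mathbf{R}^N$, $\Pi^+$ and $\Pi^-$ are the two closed half-spaces determined by $\Pi$ and $s_\Pi$ is the reflection in $\Pi$; for $f$ defined on $\mathbf{R}^N$, $f_{\Pi^+}(x)=f(x)$ if $x\in\Pi^+$ and $f(s_\Pi(x))$ if $x\in\Pi^-$; $f_{\Pi^-}(x)=f(x)$ if $x\in\Pi^-$ and $f(s_\Pi(x))$ if $x\in\Pi^+$. A space $\mathcal{X}$ of functions on $\mathbf{R}^N$ is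 admissible if it is nonempty and: (i) $\mathcal{X}\subset L^1_{loc}(\mathbf{R}^N,\mathbf{R})$ and $\{x\;|\;|u(x)|>\alpha\}$ has finite measure for all $u\in\mathcal{X}$, $\alpha>0$; (ii) $g(u)\in L^1_{loc}(\mathbf{R}^N)$ for all $u\in\mathcal{X}$; (iii) $|\nabla u|^p$ and $G(u)$ belong to $L^1(\mathbf{R}^N)$ for all $u\in\mathcal{X}$; (iv) $u_\sigma\in\mathcal{X}$ for all $u\in\mathcal{X}$, $\sigma>0$; (v) $u_{\Pi^+},u_{\Pi^-}\in\mathcal{X}$ for all $u\in\mathcal{X}$ and all affine hyperplanes $\Pi$ in $\mathbf{R}^N$. Functionals on $\mathcal{X}$: $J(u)=\frac1p\int_{\mathbf{R}^N}|\nabla u|^p\,dx$ and $V(u)=\int_{\mathbf{R}^N}G(u)\,dx$. ''$u$ does not change sign'' means that $u\ge0$ a.e. or $u\le0$ a.e. on $\mathbf{R}^N$. *)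

(* Defs.v *)
From HB Require Import structures.
From mathcomp Require Import all_boot all_order all_algebra.
From mathcomp Require Import all_classical all_reals all_analysis.

Set Implicit Arguments.
Unset Strict Implicit.
Unset Printing Implicit Defensive.

Import Order.TTheory GRing.Theory Num.Theory.
Import numFieldNormedType.Exports.

Local Open Scope classical_set_scope.
Local Open Scope ring_scope.

Section borel_rV.
Context {R : realType} (n : nat).

Let coord (i : 'I_n) (x : 'rV[R]_n) : R := x 0 i.

Let borel0 : g_sigma_preimage coord set0.
Proof. exact: sigma_algebra0. Qed.

Let borelC A : g_sigma_preimage coord A -> g_sigma_preimage coord (~` A).
Proof. exact: sigma_algebraC. Qed.

Let borel_bigcup (F : (set 'rV[R]_n)^nat) :
  (forall i, g_sigma_preimage coord (F i)) ->
  g_sigma_preimage coord (\bigcup_i (F i)).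
Proof. exact: sigma_algebra_bigcup. Qed.

(* The Borel sets of R^n, as the product sigma-algebra. *)
HB.instance Definition _ := @isMeasurable.Build default_measure_display
  'rV[R]_n (g_sigma_preimage coord) borel0 borelC borel_bigcup.

Lemma measurable_rV_coord (i : 'I_n) :
  measurable_fun [set: 'rV[R]_n] (fun x => x 0 i).
Proof.
move=> _ B mB; apply: sub_sigma_algebra; rewrite (bigD1 i)//=; left.
by exists B.
Qed.

Lemma measurable_fun_rV d (T : measurableType d) (f : T -> 'rV[R]_n) :
  (forall i, measurable_fun setT (fun t => f t 0 i)) -> measurable_fun setT f.
Proof.
move=> mf; apply: (@measurability _ _ _ _ _ _
  (\big[setU/set0]_(i < n) preimage_set_system setT (coord i) measurable)) => //.
move=> _ [A + <-]; elim/big_ind: _ => [//|P Q hP hQ [/hP|/hQ]//|i _].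
by move=> -[B mB <-]; rewrite setTI; exact: mf.
Qed.

End borel_rV.

Section product_lebesgue.
Context {R : realType}.

Definition cons_rV n (xy : R * 'rV[R]_n) : 'rV[R]_n.+1 :=
  row_mx (xy.1)%:M xy.2.

Definition uncons_rV n (x : 'rV[R]_n.+1) : R * 'rV[R]_n :=
  (x 0 ord0, \row_i x 0 (lift ord0 i)).

Lemma cons_rV0 n (xy : R * 'rV[R]_n) : cons_rV xy 0 ord0 = xy.1.
Proof.
rewrite (_ : ord0 = lshift n (0 : 'I_1)); last exact/val_inj.
by rewrite [LHS]row_mxEl mxE.
Qed.

Lemma cons_rVS n (xy : R * 'rV[R]_n) i :
  cons_rV xy 0 (lift ord0 i) = xy.2 0 i.
Proof.
rewrite (_ : lift ord0 i = rshift 1 i); last exact/val_inj.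
by rewrite [LHS]row_mxEr.
Qed.

Lemma cons_rVK n : cancel (@cons_rV n) (@uncons_rV n).
Proof.
move=> [x y]; rewrite /uncons_rV cons_rV0; congr pair.
by apply/rowP => i; rewrite mxE cons_rVS.
Qed.

Lemma measurable_cons_rV n : measurable_fun setT (@cons_rV n).
Proof.
apply: measurable_fun_rV => i; case: (unliftP ord0 i) => [j ->|->].
  rewrite (_ : (fun _ => _) = (fun x : 'rV[R]_n => x 0 j) \o snd).
    by apply: measurableT_comp => //; exact: measurable_rV_coord.
  by apply/funext => xy /=; rewrite cons_rVS.
rewrite (_ : (fun _ => _) = fst)//.
by apply/funext => xy; rewrite cons_rV0.
Qed.

Lemma measurable_uncons_rV n : measurable_fun setT (@uncons_rV n).
Proof.
apply/measurable_fun_pairP; split => /=; first exact: measurable_rV_coord.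
apply: measurable_fun_rV => i.
rewrite (_ : (fun _ => _) = fun x : 'rV[R]_n.+1 => x 0 (lift ord0 i)).
  exact: measurable_rV_coord.
by apply/funext => x /=; rewrite mxE.
Qed.

Section step.
Variables (n : nat) (nu : {sigma_finite_measure set 'rV[R]_n -> \bar R}).

Definition lebesgue_cons : set 'rV[R]_n.+1 -> \bar R :=
  pushforward (@lebesgue_measure R \x nu)%E (@cons_rV n).


Let lebesgue_cons0 : lebesgue_cons set0 = 0%E.
Proof. by rewrite /lebesgue_cons /pushforward preimage_set0 measure0. Qed.

Let lebesgue_cons_ge0 A : (0 <= lebesgue_cons A)%E.
Proof. exact: (measure_ge0 (lebesgue_measure \x nu)%E). Qed.

Let lebesgue_cons_sigma_additive : semi_sigma_additive lebesgue_cons.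
Proof.
exact: (@measure_semi_sigma_additive _ _ _
  (measure_function_pushforward__canonical__measure_function_Measure
    (lebesgue_measure \x nu)%E (@measurable_cons_rV n))).
Qed.

HB.instance Definition _ := isMeasure.Build _ _ _ lebesgue_cons
  lebesgue_cons0 lebesgue_cons_ge0 lebesgue_cons_sigma_additive.

Let lebesgue_cons_sigma_finite : sigma_finite setT lebesgue_cons.
Proof.
have /sigma_finiteP[F [FT ndF mF]] := sigma_finiteT (@lebesgue_measure R).
have /sigma_finiteP[G [GT ndG mG]] := sigma_finiteT nu.
exists (fun k => @uncons_rV n @^-1` (F k `*` G k)).
  apply/seteqP; split => // x _.
  have [[i _ Fi] [j _ Gj]] : (\bigcup_k F k) (uncons_rV x).1 /\
    (\bigcup_k G k) (uncons_rV x).2 by rewrite -FT -GT.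
  exists (maxn i j) => //; split.
    by move: Fi; exact/subsetPset/ndF/leq_maxl.
  by move: Gj; exact/subsetPset/ndG/leq_maxr.
move=> k; have [mFk Fkoo] := mF k; have [mGk Gkoo] := mG k; split.
  rewrite -[X in measurable X]setTI; apply: measurable_uncons_rV => //.
  exact: measurableX.
rewrite /lebesgue_cons /pushforward -comp_preimage.
rewrite (_ : _ \o _ = id); last by apply/funext; exact: cons_rVK.
by rewrite preimage_id product_measure1E// lte_mul_pinfty// ge0_fin_numE.
Qed.

HB.instance Definition _ := @Measure_isSigmaFinite.Build _ _ _ lebesgue_cons
  lebesgue_cons_sigma_finite.

End step.

(* The n-dimensional Lebesgue measure on Borel sets. *)
Fixpoint lebesgue_borel n : {sigma_finite_measure set 'rV[R]_n -> \bar R} :=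
  match n with
  | 0%N => @dirac _ 'rV[R]_0 0 R
  | n'.+1 => lebesgue_cons (lebesgue_borel n')
  end.

End product_lebesgue.

(* R^n with the sigma-algebra of all Lebesgue measurable sets: the Caratheodory
   extension of lebesgue_borel is its completion. *)
Definition lebesgue_rVType (R : realType) (n : nat) :=
  caratheodory_type ((@lebesgue_borel R n)^*)%mu.

HB.instance Definition _ R n := Measurable.on (lebesgue_rVType R n).

Definition lebesgue_rV {R : realType} {n : nat} :
    set (lebesgue_rVType R n) -> \bar R :=
  @completed_measure_extension _ 'rV[R]_n R (lebesgue_borel n).

HB.instance Definition _ (R : realType) n := Measure.on (@lebesgue_rV R n).

Lemma sigma_finite_lebesgue_rV (R : realType) n :
  sigma_finite setT (@lebesgue_rV R n).
Proof.
apply: (@completed_measure_extension_sigma_finite _ 'rV[R]_n).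
exact: sigma_finiteT (lebesgue_borel n).
Qed.

HB.instance Definition _ (R : realType) n :=
  @Measure_isSigmaFinite.Build _ _ _ (@lebesgue_rV R n)
    (@sigma_finite_lebesgue_rV R n).

Lemma lebesgue_rV_box (R : realType) n (A : 'I_n -> set R) :
  (forall i, measurable (A i)) ->
  lebesgue_rV [set x : 'rV[R]_n | forall i, A i (x 0 i)] =
  (\prod_(i < n) lebesgue_measure (A i))%E.
Proof.
have mbox m (B : 'I_m -> set R) : (forall i, measurable (B i)) ->
    measurable [set x : 'rV[R]_m | forall i, B i (x 0 i)].
  move=> mB; rewrite [X in measurable X](_ : _ =
      \big[setI/setT]_(i < m) ((fun x : 'rV[R]_m => x 0 i) @^-1` B i)).
    apply: bigsetI_measurable => i _; rewrite -[X in measurable X]setTI.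
    exact: measurable_rV_coord.
  apply/seteqP; split => x /= => [h|h i].
    by elim/big_ind: _ => // i _; exact: h.
  by move: h; rewrite (bigD1 i)//= => -[].
move=> mA; rewrite /lebesgue_rV /completed_measure_extension.
rewrite measurable_mu_extE; last exact: mbox.
elim: n A mA => [|n IH] A mA.
  rewrite big_ord0 /= diracE mem_set//; by case.
rewrite big_ord_recl -IH//= /lebesgue_cons /pushforward -product_measure1E//.
  congr (_ _); apply/seteqP; split => -[x y] /=.
    by move=> h; split => [|i]; [have := h ord0|have := h (lift ord0 i)];
      rewrite ?cons_rV0 ?cons_rVS.
  move=> [Ax Ay] i; case: (unliftP ord0 i) => [j ->|->].
    by rewrite cons_rVS; exact: Ay.
  by rewrite cons_rV0.
- exact: mA.
- by apply: (mbox _ (fun i => A (lift ord0 i))) => i; exact: mA.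
Qed.

Section euclidean.
Context {R : realType} {n : nat}.
Implicit Types (x y a : 'rV[R]_n) (b : R) (f : 'rV[R]_n -> R).

Definition dotv x y : R := \sum_i x 0 i * y 0 i.

(* `|x| on 'rV[R]_n is the sup norm, hence this Euclidean one. *)
Definition norm2 x : R := Num.sqrt (dotv x x).

Definition dilate (sigma : R) f : 'rV[R]_n -> R := fun x => f (sigma^-1 *: x).

(* A hyperplane is given by an equation dotv a x = b with a != 0. *)
Definition reflect_hyp a b x := x - (2 * (dotv a x - b) / dotv a a) *: a.

Definition fold_above a b f : 'rV[R]_n -> R :=
  fun x => if b <= dotv a x then f x else f (reflect_hyp a b x).

Definition fold_below a b f : 'rV[R]_n -> R :=
  fun x => if dotv a x <= b then f x else f (reflect_hyp a b x).

End euclidean.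

Section weak_gradient.
Context {R : realType} {n : nat}.
Implicit Types f u phi : 'rV[R]_n -> R.

Notation mu := (@lebesgue_rV R n).

Definition Lloc1 f :=
  measurable_fun setT (f : lebesgue_rVType R n -> R) /\
  forall K : set 'rV[R]_n, compact K ->
    (\int[mu]_(x in K) `|f x|%:E < +oo)%E.

Definition L1 f := mu.-integrable setT (EFin \o f).

Definition pderiv (i : 'I_n) f : 'rV[R]_n -> R :=
  fun x => 'D_(delta_mx 0 i) f x.

Fixpoint Ck (k : nat) f : Prop :=
  continuous f /\
  if k is k'.+1 then
    forall i, (forall x, derivable f x (delta_mx 0 i)) /\ Ck k' (pderiv i f)
  else True.

Definition test_function phi :=
  (forall k, Ck k phi) /\ compact (closure [set x | phi x != 0]).

Definition is_weak_gradient u (d : 'rV[R]_n -> 'rV[R]_n) :=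
  Lloc1 u /\
  forall i, Lloc1 (fun x => d x 0 i) /\
    forall phi, test_function phi ->
      \int[mu]_x (u x * pderiv i phi x) = - \int[mu]_x (d x 0 i * phi x).

Definition weakly_differentiable u := exists d, is_weak_gradient u d.

(* Well defined up to a null set, and only when u is weakly differentiable. *)
Definition weak_gradient u : 'rV[R]_n -> 'rV[R]_n := get (is_weak_gradient u).

End weak_gradient.

Section variational_problem.
Context {R : realType} {n : nat}.
Implicit Types u : 'rV[R]_n -> R.

Notation mu := (@lebesgue_rV R n).

Definition energy (p : R) u : R :=
  p^-1 * \int[mu]_x (norm2 (weak_gradient u x) `^ p).

Definition potential (G : R -> R) u : R := \int[mu]_x G (u x).

(* Elements of X are functions, not classes: a space of classes modulo a.e.
   equality is represented by the set of all its representatives. *)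
Record admissible (p : R) (g G : R -> R) (X : set ('rV[R]_n -> R)) : Prop := {
  adm_nonempty : X !=set0;
  adm_Lloc1 : forall u, X u -> Lloc1 u;
  adm_vanish : forall u (alpha : R), X u -> 0 < alpha ->
    (mu [set x | (alpha < `|u x|)%R] < +oo)%E;
  adm_g : forall u, X u -> Lloc1 (g \o u);
  adm_grad : forall u, X u -> weakly_differentiable u;
  adm_energy : forall u, X u -> L1 (fun x => norm2 (weak_gradient u x) `^ p);
  adm_potential : forall u, X u -> L1 (G \o u);
  adm_dilate : forall u (sigma : R), X u -> 0 < sigma -> X (dilate sigma u);
  adm_fold_above : forall u (a : 'rV[R]_n) (b : R), X u -> a != 0 ->
    X (fold_above a b u);
  adm_fold_below : forall u (a : 'rV[R]_n) (b : R), X u -> a != 0 ->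
    X (fold_below a b u) }.

Definition is_minimizer (p : R) (G : R -> R) (X : set ('rV[R]_n -> R))
    (lambda : R) u :=
  [/\ X u, potential G u = lambda &
      forall v, X v -> potential G v = lambda -> energy p u <= energy p v].

Definition infimum_energy (p : R) (G : R -> R) (X : set ('rV[R]_n -> R))
    (lambda : R) : \bar R :=
  ereal_inf [set (energy p u)%:E | u in [set u | X u /\ potential G u = lambda]].

Definition constant_sign u :=
  {ae mu, forall x, 0 <= u x} \/ {ae mu, forall x, u x <= 0}.

End variational_problem.

(* Main.v *)
Require Import Defs.
From mathcomp Require Import all_boot all_order all_algebra.
From mathcomp Require Import all_classical all_reals all_analysis.
From mathcomp Require Import measurable_realfun ring lra.

(** Why a minimizer does not change sign. Split u into u1 = max(u, 0) and
u2 = min(u, 0). Both the potential and the energy are additive: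
V(u) = V(u1) + V(u2) and J(u) = J(u1) + J(u2) ([potential_split],
[energy_split]). A dilation of ratio s multiplies V by s^N and J by s^(N - p);
with a = 1 - p/N this gives J(v) >= T V(v)^a whenever V(v) > 0, and
J(u) <= T lambda^a ([energy_lower_bound], [energy_minimizer]). If V(u1) and
V(u2) are both positive, the strict superadditivity of r^a on the half-line
contradicts these bounds. Otherwise, say V(u2) <= 0; then V(u1) >= lambda, so
u1 already has all the energy of u, and J(u2) = 0. Hence u2 has zero gradient,
and since the sets where |u2| exceeds a positive number have finite measure,
u2 = 0.

The analytic content is in two facts on weak derivatives. First, the gradient
of w >= 0 vanishes almost everywhere on the set where w = 0
([weak_partial_eq0]); so the gradients of u1 and u2 are almost nowhere both
nonzero, and the energy is additive. Second, a function with zero gradient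
whose superlevel sets have finite measure is zero ([weak_partial0_translate],
[periodic_ae_eq0]). Both follow from one formula ([is_derive_pairing_indic]):
if w has weak derivative d in the direction e, then for every bounded
measurable set A the integral of w over A + te is differentiable in t, with
derivative the integral of d over A + te.
When A lies in the zero set of w >= 0, this integral is minimal at t = 0, so the
integral of d over A is zero. When d = 0, it is constant in t, so w is invariant
under the translation by e; then a superlevel set has the same measure below
all the hyperplanes x_i = k with k an integer, and is null if its measure is
finite.

With a smooth test function in place of the indicator of A, the formula is
differentiation under the integral sign. It extends to indicators of boxes, and
to all bounded measurable sets by the pi-lambda theorem ([indic_ind]), because
the derivatives converge locally uniformly in t under bounded pointwise
convergence ([pairing_translate_cvg0]). The test functions are products of
functions of one variable derived from exp(-c/(s - a) - c/(b - s)), which tends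
to the indicator of ]a, b[ as c tends to 0. Uniqueness of weak derivatives
([fundamental_lemma]) is obtained along the same lines; it yields the
additivity of gradients and their behaviour under dilations. *)

Set Implicit Arguments.
Unset Strict Implicit.
Unset Printing Implicit Defensive.

Import Order.TTheory GRing.Theory Num.Theory.
Import numFieldNormedType.Exports.

Local Open Scope classical_set_scope.
Local Open Scope ring_scope.

(** * Borel sets and Lebesgue measure of R^n *)

Lemma measureD_null d (T : measurableType d) (R : realType)
    (m : {measure set T -> \bar R}) (A B : set T) :
  measurable A -> measurable B -> A `<=` B -> (m A < +oo)%E -> m B = m A ->
  m (B `\` A) = 0%E.
Proof.
move=> mA mB AB Aoo BA.
rewrite measureD//; last by move: Aoo; rewrite -BA.
rewrite setIidr//; suff : (m B - m A = 0)%E by [].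
by rewrite BA subee// ge0_fin_numE.
Qed.

Section boxes.
Context {R : realType} {n : nat}.
Implicit Types (a b : 'rV[R]_n).

Notation mu := (@lebesgue_rV R n).
Notation T := (lebesgue_rVType R n).

Definition obox a b : set 'rV[R]_n :=
  [set x | forall i, x 0 i \in `]a 0 i, b 0 i[].

Lemma measurable_borel_box (A : 'I_n -> set R) : (forall i, measurable (A i)) ->
  measurable [set x : 'rV[R]_n | forall i, A i (x 0 i)].
Proof.
move=> mA; rewrite [X in measurable X](_ : _ = \big[setI/setT]_(i < n)
    ((fun x : 'rV[R]_n => x 0 i) @^-1` A i)).
  apply: bigsetI_measurable => i _; rewrite -[X in measurable X]setTI.
  exact: measurable_rV_coord.
apply/seteqP; split => x /= => [h|h i].
  by elim/big_ind: _ => // i _; exact: h.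
by move: h; rewrite (bigD1 i)//= => -[].
Qed.

Lemma measurable_borel_obox a b : measurable (obox a b).
Proof.
exact: (measurable_borel_box (fun i => measurable_itv `]a 0 i, b 0 i[)).
Qed.

Lemma borel_measurable_completed (A : set 'rV[R]_n) :
  measurable A -> measurable (A : set T).
Proof. exact: caratheodory_measurable_mu_ext. Qed.

Lemma measurable_obox a b : measurable (obox a b : set T).
Proof. exact: borel_measurable_completed (measurable_borel_obox a b). Qed.

Lemma oboxI a b a' b' : obox a b `&` obox a' b' =
  obox (\row_i Num.max (a 0 i) (a' 0 i)) (\row_i Num.min (b 0 i) (b' 0 i)).
Proof.
apply/seteqP; split => x /=.
  move=> [h h'] i; move: (h i) (h' i); rewrite !in_itv/= !mxE gt_max lt_min.
  by move=> /andP[-> ->] /andP[-> ->].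
move=> h; split => i; move: (h i); rewrite !in_itv/= !mxE gt_max lt_min.
  by move=> /andP[/andP[-> _] /andP[-> _]].
by move=> /andP[/andP[_ ->] /andP[_ ->]].
Qed.

(** The Borel sets are generated by the half-spaces x_i > r, whose traces on a
box are boxes; hence the pi-lambda theorem applies to boxes. *)
Lemma borel_obox_ind a b (P : set (set 'rV[R]_n)) :
  (forall a' b', obox a' b' `<=` obox a b -> P (obox a' b')) ->
  (forall A B, measurable A -> measurable B -> B `<=` A -> A `<=` obox a b ->
    P A -> P B -> P (A `\` B)) ->
  (forall A : (set 'rV[R]_n)^nat, (forall k, measurable (A k)) ->
    (forall k, A k `<=` obox a b) -> nondecreasing_seq A ->
    (forall k, P (A k)) -> P (\bigcup_k A k)) ->
  forall A, measurable A -> A `<=` obox a b -> P A.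
Proof.
move=> Pbox PD Pcup.
pose G := [set X | exists a' b', X = obox a' b' /\ X `<=` obox a b].
pose H := [set A : set 'rV[R]_n | [/\ measurable A, A `<=` obox a b & P A]].
have mB := measurable_borel_obox a b.
have setIG : setI_closed G.
  move=> _ _ [a1 [b1 [-> s1]]] [a2 [b2 [-> s2]]].
  rewrite oboxI; do 2 eexists; split; first by [].
  by rewrite -oboxI => x [/s1].
have sub X : <<s obox a b, G >> X -> X `<=` obox a b.
  apply: (@smallest_sub _ (sigma_algebra (obox a b)) G [set X | X `<=` obox a b]).
    split; [by move=> x|by move=> A _ x []|].
    by move=> F FB; apply: bigcup_sub => k _; exact: FB.
  by move=> Y [a' [b' [-> ]]].
have GH : <<s obox a b, G >> `<=` H.
  apply: lambda_system_subset => //.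
    split.
    - by move=> A [].
    - by split => //; exact: Pbox.
    - move=> A B BA [mA AB PA] [mB' BB PB]; split; first exact: measurableD.
        by move=> x [/AB].
      exact: PD.
    - move=> F ndF HF; split.
      + by apply: bigcupT_measurable => k; have [] := HF k.
      + by apply: bigcup_sub => k _; have [] := HF k.
      + by apply: Pcup => // k; have [] := HF k.
  move=> _ [a' [b' [-> s]]]; split => //; first exact: measurable_borel_obox.
  exact: Pbox.
move=> A mA AB; suff /GH[] : <<s obox a b, G >> A by [].
suff: <<s obox a b, G >> (A `&` obox a b) by rewrite setIidl.
have sG : sigma_algebra (obox a b) <<s obox a b, G >> by exact: smallest_sigma_algebra.
have [sG0 sGD sGU] := sG.
have sGT : <<s obox a b, G >> (obox a b).
  by have := sGD _ sG0; rewrite setD0.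
move: {AB} A mA.
pose K := [set A : set 'rV[R]_n | <<s obox a b, G >> (A `&` obox a b)].
suff : measurable `<=` K by [].
apply: smallest_sub.
  split => /=.
  - by rewrite /K/= set0I.
  - move=> A KA; rewrite /K/= setTD.
    have := sGD _ KA; congr (<<s _ , _ >> _).
    by apply/seteqP; split => x /= => [[? h]|[? ?]]; split => // ?; [exact: h|tauto].
  - by move=> F KF; rewrite /K/= setI_bigcupl; exact: sGU.
move=> X; elim/big_ind: _ => // [P1 P2 h1 h2 [/h1|/h2]//|i _].
move=> -[M mM <-]; rewrite setTI.
pose L := [set M : set R | K ((fun x : 'rV[R]_n => x 0 i) @^-1` M)].
suff : measurable `<=` L by apply.
have mE : measurable = (@RGenOInfty.G R).-sigma.-measurable :> set (set R).
  exact: RGenOInfty.measurableE.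
rewrite mE; apply: smallest_sub.
  split.
  - by rewrite /L/= preimage_set0 /K/= set0I.
  - move=> A; rewrite /L/K/= setTD preimage_setC => KA.
    have := sGD _ KA; congr (<<s _ , _ >> _).
    by apply/seteqP; split => x /= => [[? h]|[? ?]]; split => // ?; [exact: h|tauto].
  - by move=> F KF; rewrite /L/K/= preimage_bigcup setI_bigcupl; exact: sGU.
move=> _ [r ->]; rewrite /L/K/=; apply: sub_sigma_algebra.
exists (\row_j if j == i then Num.max (a 0 j) r else a 0 j), b; split; last first.
  by move=> x [].
apply/seteqP; split => x /=.
  move=> [xr xab] j; move: (xab j); rewrite !in_itv/= !mxE.
  case: eqP => // ->; rewrite gt_max => /andP[-> ->].
  by move: xr; rewrite in_itv/= andbT => ->.
move=> h; split.
  by move: (h i); rewrite !in_itv/= mxE eqxx gt_max andbT => /andP[/andP[]].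
move=> j; move: (h j); rewrite !in_itv/= !mxE; case: eqP => // _.
by rewrite gt_max => /andP[/andP[-> _] ->].
Qed.

Lemma lebesgue_rV_borelE (A : set 'rV[R]_n) : measurable A ->
  mu A = lebesgue_borel n A.
Proof. exact: measurable_mu_extE. Qed.

Lemma lebesgue_rV_oboxE a b : mu (obox a b) =
  (\prod_(i < n) (Num.max (b 0 i - a 0 i) 0)%:E)%E.
Proof.
have -> : obox a b =
  [set x : 'rV[R]_n | forall i, [set` `]a 0 i, b 0 i[] (x 0 i)] by [].
rewrite (@lebesgue_rV_box R n (fun i => [set` `]a 0 i, b 0 i[]))//.
apply: eq_bigr => i _; rewrite lebesgue_measure_itv/= lte_fin.
case: ltP => h; first by rewrite -EFinB max_l// subr_ge0 ltW.
by rewrite max_r// subr_le0.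
Qed.

Lemma lebesgue_rV_obox_lty a b : (mu (obox a b) < +oo)%E.
Proof. by rewrite lebesgue_rV_oboxE prodEFin ltry. Qed.

Lemma lebesgue_rV_complete : measure_is_complete mu.
Proof. exact: measure_is_complete_caratheodory. Qed.

(** Measures are infima over countable Borel covers, so covers of nearly
minimal mass can be intersected. *)
Lemma borel_hull (A : set T) : measurable A -> (mu A < +oo)%E ->
  exists B : set 'rV[R]_n, [/\ measurable B, A `<=` B & mu B = mu A].
Proof.
move=> mA Aoo.
have Afin : mu A \is a fin_num by rewrite ge0_fin_numE.
have /choice[B /all_and3[mB AB muB]] k : exists B : set 'rV[R]_n,
    [/\ measurable B, A `<=` B & (mu B <= mu A + (k.+1%:R^-1)%:E)%E].
  have k0 : 0 < k.+1%:R^-1 :> R by [].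
  have [_ [F [mF AF] <-] FA] := lb_ereal_inf_adherent k0 Afin.
  exists (\bigcup_k F k); split => //; first exact: bigcupT_measurable.
  apply: le_trans (ltW FA); rewrite lebesgue_rV_borelE; last exact: bigcupT_measurable.
  by apply: measure_sigma_subadditive => //; exact: bigcupT_measurable.
exists (\bigcap_k B k); have mC : measurable (\bigcap_k B k) by exact: bigcapT_measurable.
have AC : A `<=` \bigcap_k B k by move=> x Ax k _; exact: AB.
split=> //; apply/eqP; rewrite eq_le; apply/andP; split; last first.
  by apply: le_measure => //; rewrite inE//; exact: borel_measurable_completed.
apply/lee_addgt0Pr => e e0.
near \oo => k.
apply: (@le_trans _ _ (mu (B k))).
  apply: le_measure; rewrite ?inE; [exact: borel_measurable_completed|
    exact: borel_measurable_completed|exact: bigcap_inf].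
apply: le_trans (muB k) _; rewrite leeD2l// lee_fin.
by near: k; apply: filterS (near_infty_natSinv_lt (PosNum e0)) => k' /ltW.
Unshelve. all: by end_near. Qed.

(** The inner set is the complement in the box of a hull of the complement
of A. *)
Lemma borel_sandwich a b (A : set T) : measurable A -> A `<=` obox a b ->
  exists B C : set 'rV[R]_n, [/\ measurable B, measurable C,
    B `<=` A /\ A `<=` C, C `<=` obox a b & mu (C `\` B) = 0%E].
Proof.
move=> mA AQ; have mQ := measurable_obox a b.
have lty (E : set T) : measurable E -> E `<=` obox a b -> (mu E < +oo)%E.
  move=> mE EQ; apply: le_lt_trans (lebesgue_rV_obox_lty a b).
  by apply: le_measure; rewrite ?inE.
have [C [mC AC muC]] := borel_hull mA (lty _ mA AQ).
have sQ : obox a b `\` A `<=` obox a b by move=> x [].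
have mQA : measurable (obox a b `\` A : set T) by exact: measurableD.
have [D [mD QD muD]] := borel_hull mQA (lty _ mQA sQ).
have mC' := borel_measurable_completed mC.
have mD' := borel_measurable_completed mD.
have mB' := measurable_borel_obox a b.
exists (obox a b `\` D), (C `&` obox a b); split.
- exact: measurableD.
- exact: measurableI.
- split => x => [[Qx Dx]|Ax]; last by split; [exact: AC|exact: AQ].
  by apply: contrapT => Ax; apply: Dx; exact: QD.
- by move=> x [].
have CA0 : mu (C `\` A) = 0%E by apply: measureD_null => //; exact: lty.
have DA0 : mu (D `\` (obox a b `\` A)) = 0%E.
  by apply: measureD_null => //; exact: lty.
apply/eqP; rewrite -measure_le0.
apply: (@le_trans _ _ (mu (C `\` A) + mu (D `\` (obox a b `\` A)))%E); last first.
  by rewrite CA0 DA0 adde0.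
apply: (le_trans _ (measureU2 _ _ _)); try exact: measurableD.
apply: le_measure; rewrite ?inE.
- by apply: measurableD; [exact: measurableI|exact: measurableD].
- by apply: measurableU; exact: measurableD.
move=> x [[Cx Qx] nx]; have [Ax|Ax] := pselect (A x); last by left; split.
right; split; last by case.
by apply: contrapT => Dx; exact: nx.
Qed.

(** The first three conditions reach all Borel subsets of the box by the
pi-lambda theorem; the last one passes to the completion. *)
Lemma obox_ind a b (P : set (set T)) :
  (forall a' b', obox a' b' `<=` obox a b -> P (obox a' b')) ->
  (forall A B : set T, measurable A -> measurable B -> B `<=` A ->
    A `<=` obox a b -> P A -> P B -> P (A `\` B)) ->
  (forall A : (set T)^nat, (forall k, measurable (A k)) ->
    (forall k, A k `<=` obox a b) -> nondecreasing_seq A ->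
    (forall k, P (A k)) -> P (\bigcup_k A k)) ->
  (forall A B : set T, measurable A -> measurable B -> B `<=` A ->
    A `<=` obox a b -> mu (A `\` B) = 0%E -> P B -> P A) ->
  forall A : set T, measurable A -> A `<=` obox a b -> P A.
Proof.
move=> Pbox PD Pcup Pnull A mA AQ.
have [B [C [mB mC [BA AC] CQ CB0]]] := borel_sandwich mA AQ.
have mB' := borel_measurable_completed mB.
have mC' := borel_measurable_completed mC.
apply: (Pnull A B) => //.
  apply/eqP; rewrite -measure_le0 -[leRHS]CB0.
  apply: le_measure; rewrite ?inE; try exact: measurableD.
  by move=> x [/AC].
have : B `<=` obox a b by exact: subset_trans AQ.
apply: (borel_obox_ind Pbox _ _ mB).
  by move=> E F mE mF; apply: PD; exact: borel_measurable_completed.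
by move=> F mF; apply: Pcup => k; exact: borel_measurable_completed.
Qed.

End boxes.

(** * Translations and dilations of Lebesgue measure *)

Section cubes.
Context {R : realType} {n : nat}.

Definition cube (k : nat) : set 'rV[R]_n :=
  obox (const_mx (- k%:R)) (const_mx k%:R).

Lemma cubeP k (x : 'rV[R]_n) : cube k x <-> forall i, `|x 0 i| < k%:R.
Proof.
split=> h i; have := h i; first by rewrite in_itv/= !mxE ltr_norml.
by rewrite ltr_norml in_itv/= !mxE.
Qed.

Lemma nondecreasing_cube : nondecreasing_seq cube.
Proof.
move=> k l kl; rewrite subsetEset => x /cubeP h; apply/cubeP => i.
by apply: lt_le_trans (h i) _; rewrite ler_nat.
Qed.

Lemma obox_sub_cube (a b : 'rV[R]_n) : exists k, obox a b `<=` cube k.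
Proof.
near \oo => k; exists k => x xab; apply/cubeP => i.
have := xab i; rewrite in_itv/= => /andP[ax xb].
rewrite (@le_lt_trans _ _ (\sum_j (`|a 0 j| + `|b 0 j|)))//.
  rewrite (bigD1 i)//= (@le_trans _ _ (`|a 0 i| + `|b 0 i|))//; last first.
    by rewrite lerDl sumr_ge0// => j _; rewrite addr_ge0.
  have := ler_norm (b 0 i); have := lerNnormlW (lexx `|a 0 i|).
  have := normr_ge0 (a 0 i); have := normr_ge0 (b 0 i).
  by rewrite ler_norml; lra.
by near: k; exact: nbhs_infty_gtr.
Unshelve. all: by end_near. Qed.

Lemma bigcup_cube : \bigcup_k cube k = setT.
Proof.
apply/seteqP; split => // x _.
have [k sk] := obox_sub_cube (x - const_mx 1) (x + const_mx 1).
exists k => //; apply: sk => i; rewrite in_itv/= !mxE; apply/andP; split; lra.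
Qed.

End cubes.

Section affine.
Context {R : realType} {n : nat}.

Notation mu := (@lebesgue_rV R n).
Notation T := (lebesgue_rVType R n).

Definition affine (s : R) (v x : 'rV[R]_n) : 'rV[R]_n := s *: x + v.

Lemma preimage_affine_obox (s : R) v a b : 0 < s ->
  affine s v @^-1` obox a b = obox (s^-1 *: (a - v)) (s^-1 *: (b - v)).
Proof.
move=> s0; apply/seteqP; split => x h i; have := h i;
by rewrite !in_itv/= !mxE ltr_pdivrMl// ltr_pdivlMl// ltrBlDr ltrBrDr.
Qed.

Lemma measurable_borel_affine (s : R) v :
  measurable_fun setT (affine s v : 'rV[R]_n -> 'rV[R]_n).
Proof.
apply: measurable_fun_rV => i.
rewrite (_ : (fun _ => _) = (fun x : 'rV[R]_n => s * x 0 i + v 0 i)); last first.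
  by apply/funext => x; rewrite /affine !mxE.
apply: measurable_funD => //; apply: measurable_funM => //.
exact: measurable_rV_coord.
Qed.

(** The formula can be read off on boxes. Borel subsets of a box follow by the
pi-lambda theorem; this shows that preimages of null sets are null, which gives
the Lebesgue measurable subsets of a box, and then unbounded sets by exhaustion.
*)
Lemma lebesgue_rV_affine (s : R) v (A : set T) : 0 < s -> measurable A ->
  measurable (affine s v @^-1` A : set T) /\
  mu (affine s v @^-1` A) = ((s^-1 ^+ n)%:E * mu A)%E.
Proof.
move=> s0; set c := s^-1 ^+ n; set t := affine s v.
have c0 : 0 < c by rewrite exprn_gt0// invr_gt0.
have mt (E : set 'rV[R]_n) : measurable E -> measurable (t @^-1` E).
  by move=> mE; rewrite -[X in measurable X]setTI; exact: measurable_borel_affine.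
have mt' (E : set 'rV[R]_n) : measurable E -> measurable (t @^-1` E : set T).
  by move=> mE; apply: borel_measurable_completed; exact: mt.
have lty (a b : 'rV[R]_n) (E : set T) : measurable E -> E `<=` obox a b ->
    (mu E < +oo)%E.
  move=> mE EQ; apply: le_lt_trans (lebesgue_rV_obox_lty a b).
  by apply: le_measure; rewrite ?inE//; exact: measurable_obox.
have lty' (a b : 'rV[R]_n) (E : set T) : measurable (t @^-1` E : set T) ->
    E `<=` obox a b -> (mu (t @^-1` E) < +oo)%E.
  move=> mE EQ.
  apply: (lty (s^-1 *: (a - v)) (s^-1 *: (b - v))) => //.
  by rewrite -preimage_affine_obox//; exact: preimage_subset.
have key (a b : 'rV[R]_n) (E : set 'rV[R]_n) : measurable E ->
    E `<=` obox a b -> mu (t @^-1` E) = (c%:E * mu E)%E.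
  move: E; apply: borel_obox_ind.
  - move=> a' b' _; rewrite preimage_affine_obox// !lebesgue_rV_oboxE !prodEFin.
    rewrite -EFinM; congr EFin.
    rewrite /c -[X in _ ^+ X]card_ord -prodr_const -big_split/=.
    apply: eq_bigr => i _; rewrite !mxE -mulrBr maxr_pMr ?invr_ge0 ?(ltW s0)//.
    by rewrite mulr0; congr (Num.max (_ * _) _); lra.
  - move=> E F mE mF FE EQ eE eF.
    have mE' := borel_measurable_completed mE.
    have mF' := borel_measurable_completed mF.
    have -> : t @^-1` (E `\` F) = t @^-1` E `\` t @^-1` F by [].
    transitivity (mu (t @^-1` E) - mu (t @^-1` F))%E.
      have := @measureD _ _ _ mu _ _ (mt' _ mE) (mt' _ mF) (lty' _ _ _ (mt' _ mE) EQ).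
      by rewrite -preimage_setI (setIidr FE).
    transitivity (c%:E * (mu E - mu F))%E.
      rewrite eE eF muleBr// fin_num_adde_defr//.
      by rewrite ge0_fin_numE//; exact: (lty a b).
    congr (_ * _)%E; apply/esym.
    by have := @measureD _ _ _ mu _ _ mE' mF' (lty _ _ _ mE' EQ); rewrite (setIidr FE).
  - move=> F mF FQ ndF eF.
    have mF' k := borel_measurable_completed (mF k).
    rewrite preimage_bigcup.
    have h1 : mu (t @^-1` F k) @[k --> \oo] --> mu (\bigcup_k (t @^-1` F k)).
      apply: (@nondecreasing_cvg_mu _ _ _ mu).
      + by move=> k; exact: mt'.
      + by apply: bigcupT_measurable => k; exact: mt'.
      + move=> k l kl; apply/subsetPset; apply: preimage_subset.
        exact/subsetPset/ndF.
    have h2 : mu (F k) @[k --> \oo] --> mu (\bigcup_k F k).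
      apply: (@nondecreasing_cvg_mu _ _ _ mu) => //.
      exact: bigcupT_measurable.
    apply: (cvg_unique _ h1) => //.
    rewrite (_ : (fun k => _) = fun k => (c%:E * mu (F k))%E); last exact/funext.
    exact: cvgeZl.
have null (a b : 'rV[R]_n) (E F : set 'rV[R]_n) (G : set T) :
    measurable E -> measurable F -> F `<=` obox a b -> mu (F `\` E) = 0%E ->
    G `<=` F `\` E -> measurable (t @^-1` G : set T) /\ mu (t @^-1` G) = 0%E.
  move=> mE mF FQ FE0 GFE.
  have mFE : measurable (F `\` E) by exact: measurableD.
  have e0 : mu (t @^-1` (F `\` E)) = 0%E.
    by rewrite (key a b)// ?FE0 ?mule0// => x [/FQ].
  have mG : measurable (t @^-1` G : set T).
    apply: lebesgue_rV_complete; exists (t @^-1` (F `\` E)); split => //.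
      exact: mt'.
    exact: preimage_subset.
  split => //; apply/eqP; rewrite -measure_le0 -[leRHS]e0.
  by apply: le_measure; rewrite ?inE//; [exact: mt'|exact: preimage_subset].
have bkey (a b : 'rV[R]_n) (E : set T) : measurable E -> E `<=` obox a b ->
    measurable (t @^-1` E : set T) /\ mu (t @^-1` E) = (c%:E * mu E)%E.
  move=> mE EQ; have [B [C [mB mC [BE EC] CQ CB0]]] := borel_sandwich mE EQ.
  have [mEB EB0] := null a b _ _ (E `\` B) mB mC CQ CB0 (setSD EC).
  have EE : E = B `|` (E `\` B).
    by rewrite setUDr setDv setD0; apply/esym/setUidPr.
  have mtE : measurable (t @^-1` E : set T).
    by rewrite EE preimage_setU; apply: measurableU => //; exact: mt'.
  split => //.
  have mB' := borel_measurable_completed mB.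
  have mC' := borel_measurable_completed mC.
  have -> : mu (t @^-1` E) = mu (t @^-1` B).
    rewrite EE preimage_setU.
    exact: (@measureU0 _ _ _ mu _ _ (mt' _ mB) mEB EB0).
  rewrite (key a b)//; last exact: subset_trans EQ.
  congr (_ * _)%E; rewrite [in RHS]EE; apply/esym.
  apply: (@measureU0 _ _ _ mu) => //; first exact: measurableD.
  apply/eqP; rewrite -measure_le0 -[leRHS]CB0.
  apply: le_measure; rewrite ?inE; try exact: measurableD.
  exact: setSD.
move=> mA; have AE : A = \bigcup_k (A `&` cube k).
  by rewrite -setI_bigcupr bigcup_cube setIT.
have mAk k : measurable (A `&` cube k : set T).
  by apply: measurableI => //; exact: measurable_obox.
have ndA : nondecreasing_seq (fun k => A `&` cube k).
  move=> k l kl; apply/subsetPset; apply: setIS.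
  exact/subsetPset/nondecreasing_cube.
have bA k := bkey _ _ _ (mAk k) (@subIsetr _ _ _).
have AE' : t @^-1` A = \bigcup_k (t @^-1` (A `&` cube k)).
  by rewrite [in LHS]AE preimage_bigcup.
have mtA : measurable (t @^-1` A : set T).
  by rewrite AE'; apply: bigcupT_measurable => k; have [] := bA k.
split=> //; rewrite AE' [in RHS]AE.
have h1 : mu (t @^-1` (A `&` cube k)) @[k --> \oo] -->
    mu (\bigcup_k (t @^-1` (A `&` cube k))).
  apply: (@nondecreasing_cvg_mu _ _ _ mu).
  + by move=> k; have [] := bA k.
  + by rewrite -AE'.
  + move=> k l kl; apply/subsetPset; apply: preimage_subset.
    exact/subsetPset/ndA.
have h2 : mu (A `&` cube k) @[k --> \oo] --> mu (\bigcup_k (A `&` cube k)).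
  by apply: (@nondecreasing_cvg_mu _ _ _ mu) => //; rewrite -AE.
apply: (cvg_unique _ h1) => //.
rewrite (_ : (fun k => _) = fun k => (c%:E * mu (A `&` cube k))%E).
  exact: cvgeZl.
by apply/funext => k; have [] := bA k.
Qed.

Lemma measurable_affine (s : R) v : 0 < s ->
  measurable_fun setT (affine s v : T -> T).
Proof.
by move=> s0 _ A mA; rewrite setTI; have [] := lebesgue_rV_affine v s0 mA.
Qed.

Lemma ge0_integral_affine (s : R) v (f : T -> \bar R) : 0 < s ->
  measurable_fun setT f -> (forall x, 0 <= f x)%E ->
  (\int[mu]_x f (affine s v x) = (s^-1 ^+ n)%:E * \int[mu]_x f x)%E.
Proof.
move=> s0 mf f0.
have c0 : 0 <= s^-1 ^+ n by rewrite exprn_ge0// invr_ge0 ltW.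
transitivity (\int[pushforward mu (affine s v : T -> T)]_x f x)%E.
  rewrite ge0_integral_pushforward//; exact: measurable_affine.
transitivity (\int[mscale (NngNum c0) mu]_x f x)%E.
  apply: eq_measure_integral => [|? A mA _]; first exact: measurable_affine.
  by have [_] := lebesgue_rV_affine v s0 mA.
by rewrite ge0_integral_mscale.
Qed.

Lemma integral_affine (s : R) v (f : T -> \bar R) : 0 < s ->
  measurable_fun setT f ->
  (\int[mu]_x f (affine s v x) = (s^-1 ^+ n)%:E * \int[mu]_x f x)%E.
Proof.
move=> s0 mf; rewrite integralE [in RHS]integralE.
under eq_integral do rewrite (funepos_comp f (affine s v)) /=.
under [X in (_ - X)%E]eq_integral do rewrite (funeneg_comp f (affine s v)) /=.
rewrite !ge0_integral_affine//; [|exact: measurable_funeneg|exact: measurable_funepos].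
have c0 : 0 < s^-1 ^+ n by rewrite exprn_gt0// invr_gt0.
move: (integral _ _ f^\+%E) (integral _ _ f^\-%E) => P Q.
case: P => [P| |]; case: Q => [Q| |]; rewrite -?EFinM -?EFinB -?EFinM;
  rewrite /= ?gt0_muley ?gt0_muleNy ?lte_fin//=.
by rewrite mulrBr.
Qed.

Lemma Rintegral_affine (s : R) v (f : T -> R) : 0 < s ->
  measurable_fun setT f ->
  \int[mu]_x f (affine s v x) = s^-1 ^+ n * \int[mu]_x f x.
Proof.
move=> s0 mf.
have mf' : measurable_fun setT (fun x : T => (f x)%:E) by exact/measurable_EFinP.
transitivity (fine ((s^-1 ^+ n)%:E * \int[mu]_x (f x)%:E)%E).
  by congr fine; exact: (integral_affine v s0 mf').
rewrite /Rintegral.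
have c0 : 0 < s^-1 ^+ n by rewrite exprn_gt0// invr_gt0.
case: (integral _ _ _) => [r| |] //=.
- by rewrite gt0_muley ?lte_fin//= mulr0.
- by rewrite gt0_muleNy ?lte_fin//= mulr0.
Qed.

Lemma integrable_affine (s : R) v (D : set T) (f : T -> R) : 0 < s ->
  measurable D -> measurable_fun setT f ->
  mu.-integrable D (EFin \o f) ->
  mu.-integrable (affine s v @^-1` D) (EFin \o (f \o affine s v)).
Proof.
move=> s0 mD mf /integrableP[_ fD].
have mfs : measurable_fun setT (f \o affine s v : T -> R).
  exact: (measurableT_comp mf (measurable_affine v s0)).
have [mD' _] := lebesgue_rV_affine v s0 mD.
apply/integrableP; split; first exact/measurable_EFinP/measurable_funTS.
pose g (x : T) := `|f x|%:E.
have mg : measurable_fun setT g.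
  by apply/measurable_EFinP; exact: (measurableT_comp (@normr_measurable R setT) mf).
rewrite integral_mkcond.
rewrite (_ : _ \_ _ = fun x => (g \_ D) (affine s v x)).
  rewrite ge0_integral_affine//.
  - rewrite -integral_mkcond; apply: lte_mul_pinfty => //.
    by rewrite lee_fin exprn_ge0// invr_ge0 ltW.
  - by apply/(measurable_restrictT _ mD); exact: measurable_funTS.
  - by move=> x; rewrite patchE; case: ifP; rewrite ?lee_fin.
by apply/funext => x; rewrite !patchE.
Qed.

End affine.

(** * Smooth bump functions *)

Section flat.
Context {R : realType}.
Implicit Types (c s a b : R) (P Q : {poly R}).

(** The polynomial factor makes the family stable under derivation, and so
yields the smoothness of exp(-c/s), extended by 0, at the origin. *)
Definition flat c P s : R := if 0 < s then P.[s^-1] * expR (- c * s^-1) else 0.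

Lemma flat_eq0 c P s : s <= 0 -> flat c P s = 0.
Proof. by rewrite /flat ltNge => ->. Qed.

Definition flat_deriv c P : {poly R} := 'X^2 * (c *: P - P^`()).

(** By induction on P, spending half of the exponential decay on the new factor
y. *)
Lemma poly_expR_bounded c P : 0 < c ->
  exists2 K, 0 <= K & forall y, 0 <= y -> `|P.[y] * expR (- c * y)| <= K.
Proof.
elim/poly_ind: P c => [|P k IH] c c0.
  by exists 0 => // y _; rewrite horner0 mul0r normr0.
have c20 : 0 < c / 2 by lra.
have [K K0 KP] := IH _ c20.
exists (K * (2 / c) + `|k|).
  by rewrite addr_ge0// mulr_ge0// divr_ge0// ltW.
move=> y y0; rewrite hornerD hornerM hornerX hornerC mulrDl.
apply: le_trans (ler_normD _ _) _; apply: lerD; last first.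
  rewrite normrM ler_piMr// ger0_norm ?expR_ge0// -expR0 ler_expR mulNr.
  by rewrite oppr_le0 mulr_ge0// ltW.
have -> : P.[y] * y * expR (- c * y) =
    (P.[y] * expR (- (c / 2) * y)) * (y * expR (- (c / 2) * y)).
  by rewrite mulrACA -expRD; congr (_ * expR _); field.
rewrite normrM ler_pM//; first exact: KP.
rewrite normrM (ger0_norm y0) (ger0_norm (expR_ge0 _)) mulNr expRN.
rewrite ler_pdivrMr ?expR_gt0//.
rewrite -ler_pdivrMl ?divr_gt0// invf_div.
by apply: le_trans (expR_ge1Dx _); lra.
Qed.

Lemma flat_bounded c P : 0 < c ->
  exists2 K, 0 <= K & forall s, `|flat c P s| <= K.
Proof.
move=> c0; have [K K0 KP] := poly_expR_bounded P c0.
exists K => // s; rewrite /flat; case: ifPn => [s0|]; last by rewrite normr0.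
by apply: KP; rewrite invr_ge0 ltW.
Qed.

(** The bound for X^2 P in place of P: it makes the derivative at 0 vanish. *)
Lemma flat_quadratic c P : 0 < c ->
  exists2 K, 0 <= K & forall s, `|flat c P s| <= K * s ^+ 2.
Proof.
move=> c0; have [K K0 KP] := poly_expR_bounded ('X^2 * P) c0.
exists K => // s; rewrite /flat; case: ifPn => [s0|_]; last first.
  by rewrite normr0 mulr_ge0// sqr_ge0.
have := KP s^-1; rewrite invr_ge0 => /(_ (ltW s0)).
rewrite hornerM hornerXn -mulrA normrM -ler_pdivlMl ?normr_gt0 ?expf_neq0//.
  rewrite normrX normfV exprVn invrK => h; apply: le_trans h _.
  by rewrite (gtr0_norm s0) mulrC.
by rewrite invr_neq0// gt_eqF.
Qed.

Lemma is_derive_flat c P s : 0 < c ->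
  is_derive s 1 (flat c P) (flat c (flat_deriv c P) s).
Proof.
move=> c0; have [s0|s0|->] := ltgtP s 0.
- rewrite [X in is_derive _ _ _ X]flat_eq0 ?ltW//.
  apply: (@near_eq_is_derive _ _ _ (cst 0)).
  near=> t; rewrite flat_eq0//; apply: ltW; near: t; exact: lt_nbhsl.
- have s1 : s != 0 by rewrite gt_eqF.
  have nE : \near s, P.[s^-1] * expR (- c * s^-1) = flat c P s.
    near=> t; rewrite /flat ifT//; near: t; exact: lt_nbhsr.
  have dV : is_derive s 1 (fun t : R => t^-1) (- s ^- 2).
    by have := is_deriveV s1 (is_derive_id s 1); rewrite scaler1.
  have dP : is_derive s 1 (fun t => P.[t^-1]) (P^`().[s^-1] * (- s ^- 2)).
    exact: (@is_derive1_comp _ (horner P) (fun t => t^-1)).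
  have dc : is_derive s 1 (fun t => - c * t^-1) (- c * (- s ^- 2)).
    exact: (@is_deriveZ _ _ _ (fun t : R => t^-1) (- c)).
  have dE : is_derive s 1 (fun t => expR (- c * t^-1))
      (expR (- c * s^-1) * (- c * (- s ^- 2))).
    exact: (@is_derive1_comp _ expR (fun t => - c * t^-1)).
  apply: (near_eq_is_derive nE); apply: (is_derive_eq (is_deriveM dP dE)).
  rewrite /flat s0 /flat_deriv !hornerE/=.
  rewrite /GRing.scale/= exprVn; ring.
- rewrite flat_eq0//.
  have [K K0 KP] := flat_quadratic P c0.
  have cv : (fun h => h^-1 *: ((flat c P \o shift 0) (h *: 1) - flat c P 0))
      @ 0^' --> (0 : R).
    apply/cvgrPdist_le => e e0.
    near=> h; rewrite sub0r normrN /= (flat_eq0 c P (lexx 0)) subr0 addr0 scaler1.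
    have h0 : h != 0 by near: h; exact: nbhs_dnbhs_neq.
    rewrite normrZ normfV ler_pdivrMl ?normr_gt0//.
    apply: le_trans (KP h) _.
    rewrite -[h ^+ 2]ger0_norm ?sqr_ge0// normrX expr2 mulrCA ler_wpM2l//.
    have : `|h| <= e / (K + 1).
      near: h; apply: dnbhs0_le; rewrite divr_gt0//; lra.
    rewrite ler_pdivlMr; last lra.
    apply: le_trans; rewrite mulrC ler_wpM2l//; lra.
  apply: DeriveDef; first by apply/cvg_ex; exists 0.
  exact: cvg_lim.
Unshelve. all: by end_near. Qed.

End flat.

Section window.
Context {R : realType}.
Implicit Types (c s t a b : R) (P Q : {poly R}) (f g : R -> R).

(** Sums are included because the product rule produces them: the class is
closed under derivation. *)
Inductive window c a b : (R -> R) -> Prop :=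
| window_mul P Q : window c a b (fun s => flat c P (s - a) * flat c Q (b - s))
| window_add f g : window c a b f -> window c a b g ->
    window c a b (fun s => f s + g s).

Lemma window_eq0 c a b f s : window c a b f -> s \notin `]a, b[ -> f s = 0.
Proof.
move=> wf sab; elim: wf => [P Q|{}f g _ -> _ ->].
  move: sab; rewrite in_itv/= negb_and -!leNgt => /orP[sa|bs].
  - by rewrite flat_eq0 ?mul0r// subr_le0.
  - by rewrite (@flat_eq0 _ _ Q) ?mulr0// subr_le0.
by rewrite addr0.
Qed.

Lemma is_derive_window_mul c a b P Q s : 0 < c ->
  is_derive s 1 (fun s => flat c P (s - a) * flat c Q (b - s))
    (flat c (flat_deriv c P) (s - a) * flat c Q (b - s) +
     flat c P (s - a) * flat c (- flat_deriv c Q) (b - s)).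
Proof.
move=> c0.
have dP : is_derive s 1 (fun s => flat c P (s - a)) (flat c (flat_deriv c P) (s - a)).
  have d1 : is_derive s 1 (fun s : R => s - a) 1.
    by apply: is_derive_eq; rewrite subr0.
  have := @is_derive1_comp _ (flat c P) (fun s => s - a) s _ _
    (is_derive_flat P (s - a) c0) d1.
  by rewrite mulr1.
have dQ : is_derive s 1 (fun s => flat c Q (b - s)) (- flat c (flat_deriv c Q) (b - s)).
  have d1 : is_derive s 1 (fun s : R => b - s) (- 1).
    have := is_deriveB (is_derive_cst b s 1) (is_derive_id s 1).
    by rewrite sub0r.
  have := @is_derive1_comp _ (flat c Q) (fun s => b - s) s _ _
    (is_derive_flat Q (b - s) c0) d1.
  by rewrite mulrN1.
apply: (is_derive_eq (is_deriveM dP dQ)).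
have -> : flat c (- flat_deriv c Q) (b - s) = - flat c (flat_deriv c Q) (b - s).
  by rewrite /flat; case: ifP; rewrite ?oppr0// hornerN mulNr.
by rewrite addrC /GRing.scale/= [in X in X + _]mulrC.
Qed.

Lemma window_derive c a b f : 0 < c -> window c a b f ->
  (forall s, derivable f s 1) /\ window c a b (derive1 f).
Proof.
move=> c0; elim=> [P Q|{}f g _ [df wf] _ [dg wg]].
  split=> [s|]; first by have [] := @is_derive_window_mul c a b P Q s c0.
  rewrite (_ : derive1 _ = fun s =>
     flat c (flat_deriv c P) (s - a) * flat c Q (b - s) +
     flat c P (s - a) * flat c (- flat_deriv c Q) (b - s)).
    by apply: window_add; exact: window_mul.
  apply/funext => s; rewrite derive1E.
  by have [] := @is_derive_window_mul c a b P Q s c0.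
split=> [s|]; first exact: derivableD.
rewrite (_ : derive1 _ = fun s => derive1 f s + derive1 g s); first exact: window_add.
by apply/funext => s; rewrite !derive1E deriveD.
Qed.

Lemma window_bounded c a b f : 0 < c -> window c a b f ->
  exists2 K, 0 <= K & forall s, `|f s| <= K.
Proof.
move=> c0; elim=> [P Q|{}f g _ [K K0 fK] _ [L L0 gL]].
  have [K K0 PK] := flat_bounded P c0; have [L L0 QL] := flat_bounded Q c0.
  exists (K * L); first exact: mulr_ge0.
  by move=> s; rewrite normrM ler_pM.
exists (K + L); first exact: addr_ge0.
by move=> s; rewrite (le_trans (ler_normD _ _))// lerD.
Qed.

Lemma window_shift c a b f t : window c a b f ->
  window c (a + t) (b + t) (fun s => f (s - t)).
Proof.
elim=> [P Q|{}f g _ wf _ wg]; last exact: window_add.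
rewrite (_ : (fun _ => _) = fun s => flat c P (s - (a + t)) * flat c Q (b + t - s)).
  exact: window_mul.
by apply/funext => s; congr (flat _ _ _ * flat _ _ _); lra.
Qed.

Lemma window_continuous c a b f : 0 < c -> window c a b f -> continuous f.
Proof.
move=> c0 wf s; apply/differentiable_continuous/derivable1_diffP.
by have [] := window_derive c0 wf.
Qed.

(** This is exp(-c/(s - a) - c/(b - s)) on ]a, b[. The constant c is kept as a
parameter because the indicator of the interval is the limit as c tends to 0. *)
Definition bump1 c a b s := flat c 1 (s - a) * flat c 1 (b - s).

Lemma window_bump1 c a b : window c a b (bump1 c a b).
Proof. exact: window_mul. Qed.

Lemma bump1_itv01 c a b s : 0 < c -> 0 <= bump1 c a b s <= 1.
Proof.
move=> c0; have h t : 0 <= flat c 1 t <= 1.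
  rewrite /flat; case: ifPn => [t0|_]; last by rewrite lexx ler01.
  rewrite hornerC mul1r expR_ge0/= -expR0 ler_expR mulNr oppr_le0.
  by rewrite mulr_ge0// ?invr_ge0 ltW.
have /andP[? ?] := h (s - a); have /andP[? ?] := h (b - s).
by rewrite mulr_ge0//= mulr_ile1.
Qed.

Lemma bump1_scale c a b s t : 0 < t ->
  bump1 c a b (t * s) = bump1 (t^-1 * c) (t^-1 * a) (t^-1 * b) s.
Proof.
move=> t0; rewrite /bump1.
have h r r' : r' = t^-1 * r -> flat c 1 r = flat (t^-1 * c) 1 r'.
  move=> ->; rewrite /flat pmulr_rgt0 ?invr_gt0//; case: ifPn => // r0.
  rewrite !hornerC invfM invrK; congr (_ * expR _); field.
  by rewrite !gt_eqF.
by rewrite (h _ (s - t^-1 * a)) 1?(h _ (t^-1 * b - s))//; field; rewrite gt_eqF.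
Qed.

Lemma cvg_bump1 a b s :
  bump1 k.+1%:R^-1 a b s @[k --> \oo] --> ((s \in `]a, b[)%:R : R).
Proof.
have h t : flat k.+1%:R^-1 1 t @[k --> \oo] --> ((0 < t)%R%:R : R).
  rewrite /flat; have [t0|t0] := boolP (0 < t)%R; last exact: cvg_cst.
  under eq_fun do rewrite hornerC mul1r.
  have cV : - k.+1%:R^-1 * t^-1 @[k --> \oo] --> - 0 * t^-1.
    by apply: cvgMl; apply: cvgN; exact: cvg_harmonic.
  have := continuous_cvg _ (@continuous_expR R (- 0 * t^-1)) cV.
  rewrite oppr0 mul0r expR0; exact.
rewrite in_itv/= -(subr_gt0 a) -(subr_gt0 s) -mulnb natrM.
exact: cvgM.
Qed.

End window.

Section tensor.
Context {R : realType} {n : nat}.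
Implicit Types (c : R) (a b x : 'rV[R]_n) (chi : 'I_n -> R -> R).

Notation mu := (@lebesgue_rV R n).
Notation T := (lebesgue_rVType R n).

Definition tensor chi x := \prod_i chi i (x 0 i).

Definition windows c a b chi := forall i, window c (a 0 i) (b 0 i) (chi i).

Definition derive_at (i : 'I_n) chi j := if j == i then derive1 (chi j) else chi j.

Lemma windows_derive_at c a b chi i : 0 < c -> windows c a b chi ->
  windows c a b (derive_at i chi).
Proof.
move=> c0 w j; rewrite /derive_at; case: eqP => // _.
by have [] := window_derive c0 (w j).
Qed.

Lemma tensor_eq0 c a b chi x : windows c a b chi -> ~ obox a b x ->
  tensor chi x = 0.
Proof.
move=> w /existsNP[i /negP xi].
by rewrite /tensor (bigD1 i)//= (window_eq0 (w i))// mul0r.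
Qed.

Lemma is_derive_tensor c a b chi i x : 0 < c -> windows c a b chi ->
  is_derive x (delta_mx 0 i) (tensor chi) (tensor (derive_at i chi) x).
Proof.
move=> c0 w; have [dchi _] := window_derive c0 (w i).
pose C := \prod_(j | j != i) chi j (x 0 j).
have eC : tensor (derive_at i chi) x = C * derive1 (chi i) (x 0 i).
  rewrite /tensor (bigD1 i)//= mulrC {2}/derive_at eqxx; congr (_ * _).
  by apply: eq_bigr => j; rewrite /derive_at => /negPf ->.
have cv : (fun h => h^-1 *: ((tensor chi \o shift x) (h *: delta_mx 0 i) - tensor chi x))
    @ 0^' --> tensor (derive_at i chi) x.
  rewrite eC (_ : (fun _ => _) = fun h =>
      C * (h^-1 *: ((chi i \o shift (x 0 i)) (h *: 1) - chi i (x 0 i)))).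
    apply: cvgMr; rewrite derive1E; exact: dchi.
  apply/funext => h; rewrite /GRing.scale/= mulrCA; congr (_ * _).
  rewrite mulrBr /tensor (bigD1 i)//= [in X in _ - X](bigD1 i)//=.
  congr (_ - _); last by rewrite mulrC.
  rewrite !mxE !eqxx mulrC; congr (_ * _); apply: eq_bigr => j /negPf ji.
  by rewrite !mxE ji andbF mulr0 add0r.
by apply: DeriveDef; [apply/cvg_ex; eexists; exact: cv|exact: cvg_lim].
Qed.

Lemma pderiv_tensor c a b chi i : 0 < c -> windows c a b chi ->
  pderiv i (tensor chi) = tensor (derive_at i chi).
Proof.
move=> c0 w; apply/funext => x.
by have [] := is_derive_tensor i x c0 w.
Qed.

Lemma tensor_continuous c a b chi : 0 < c -> windows c a b chi ->
  continuous (tensor chi).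
Proof.
move=> c0 w; rewrite /tensor.
apply: (@continuous_big R _ *%R 1 xpredT _ _ _
  (fun i (x : 'rV[R]_n) => chi i (x 0 i))) => [|i _ x].
  by move=> x; apply: cvgM; [exact: cvg_fst|exact: cvg_snd].
apply: (@continuous_comp _ _ _ (fun x : 'rV[R]_n => x 0 i) (chi i)).
  exact: coord_continuous.
exact: (window_continuous c0 (w i)).
Qed.

Lemma compact_cbox a b :
  compact [set x : 'rV[R]_n | forall i, x 0 i \in `[a 0 i, b 0 i]].
Proof.
apply: (@rV_compact _ _ (fun i => [set` `[a 0 i, b 0 i]])) => i.
exact: segment_compact.
Qed.

Lemma closed_cbox a b :
  closed [set x : 'rV[R]_n | forall i, x 0 i \in `[a 0 i, b 0 i]].
Proof.
apply: compact_closed; [exact: norm_hausdorff|exact: compact_cbox].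
Qed.

(** The partial derivatives of a product of windows are again products of
windows, so smoothness follows by induction on the order. *)
Lemma test_function_tensor c a b chi : 0 < c -> windows c a b chi ->
  test_function (tensor chi).
Proof.
move=> c0 w; split.
  move=> k; elim: k chi w => [|k IH] chi w /=.
    by split => //; exact: tensor_continuous w.
  split; first exact: tensor_continuous w.
  move=> i; split=> [x|]; first by have [] := is_derive_tensor i x c0 w.
  rewrite (pderiv_tensor i c0 w); apply: IH.
  exact: windows_derive_at.
apply: (subclosed_compact _ (@compact_cbox a b)); first exact: closed_closure.
rewrite [X in _ `<=` X](closure_id _).1; last exact: closed_cbox.
apply: closure_subset.
move=> x /= /eqP x0 i; apply: contrapT => xi; apply: x0.
apply: (tensor_eq0 w) => h; apply: xi.
exact/subset_itv_oo_cc/h.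
Qed.

Lemma measurable_borel_tensor c a b chi : 0 < c -> windows c a b chi ->
  measurable_fun setT (tensor chi : 'rV[R]_n -> R).
Proof.
move=> c0 w; apply: measurable_prod => i _.
apply: (@measurableT_comp _ _ _ _ _ _ (chi i)).
  apply: continuous_measurable_fun; exact: (window_continuous c0 (w i)).
exact: measurable_rV_coord.
Qed.

Lemma measurable_tensor c a b chi : 0 < c -> windows c a b chi ->
  measurable_fun setT (tensor chi : T -> R).
Proof.
move=> c0 w _ A mA; rewrite setTI; apply: borel_measurable_completed.
by rewrite -[X in measurable X]setTI; exact: (measurable_borel_tensor c0 w).
Qed.

Lemma tensor_bounded c a b chi : 0 < c -> windows c a b chi ->
  exists2 K, 0 <= K & forall x, `|tensor chi x| <= K.
Proof.
move=> c0 w.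
have /choice[K KP] i : exists K, 0 <= K /\ forall s, `|chi i s| <= K.
  by have [K K0 KP] := window_bounded c0 (w i); exists K.
exists (\prod_i K i); first by apply: prodr_ge0 => i _; have [] := KP i.
move=> x; rewrite /tensor normr_prod; apply: ler_prod => i _.
by rewrite normr_ge0/=; have [_] := KP i.
Qed.

Definition shift1 (i : 'I_n) (t : R) chi j s :=
  if j == i then chi j (s - t) else chi j s.

Lemma windows_shift1 c a b chi i t : windows c a b chi ->
  windows c (a + t *: delta_mx 0 i) (b + t *: delta_mx 0 i) (shift1 i t chi).
Proof.
move=> w j; rewrite /shift1 !mxE eqxx/=; case: eqP => [->|_].
  by rewrite mulr1; exact: window_shift.
by rewrite mulr0 !addr0.
Qed.

Lemma tensor_shift1 chi i t x :
  tensor (shift1 i t chi) x = tensor chi (x - t *: delta_mx 0 i).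
Proof.
apply: eq_bigr => j _; rewrite /shift1 !mxE eqxx/=.
by case: eqP => _; rewrite ?mulr1// mulr0 subr0.
Qed.

Definition bump c a b := tensor (fun i => bump1 c (a 0 i) (b 0 i)).

Lemma windows_bump1 c a b : windows c a b (fun i => bump1 c (a 0 i) (b 0 i)).
Proof. by move=> i; exact: window_bump1. Qed.

Lemma bump_itv01 c a b x : 0 < c -> 0 <= bump c a b x <= 1.
Proof.
move=> c0; have h i := bump1_itv01 (a 0 i) (b 0 i) (x 0 i) c0.
rewrite prodr_ge0 => [/=|i _]; last by have /andP[] := h i.
apply: prodr_ile1 => i _; exact: h.
Qed.

Lemma cvg_bump a b x :
  bump k.+1%:R^-1 a b x @[k --> \oo] --> (\1_(obox a b) x : R).
Proof.
rewrite (_ : \1_(obox a b) x = \prod_i ((x 0 i \in `]a 0 i, b 0 i[)%:R : R)).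
  rewrite /bump /tensor; apply: (@cvg_big R _ *%R 1 xpredT _ _ _ _
    (fun i k => bump1 k.+1%:R^-1 (a 0 i) (b 0 i) (x 0 i))) => [|i _].
    by move=> y; apply: cvgM; [exact: cvg_fst|exact: cvg_snd].
  exact: cvg_bump1.
rewrite indicE; have [xab|xab] := pselect (obox a b x).
  by rewrite mem_set// big1// => i _; rewrite xab.
rewrite memNset//; move/existsNP : xab => [i /negP/negPf xi].
by rewrite (bigD1 i)//= xi mul0r.
Qed.

End tensor.

(** * Integration against bounded functions of bounded support *)

Section Rintegral_facts.
Context d (Y : measurableType d) (R : realType) (m : {measure set Y -> \bar R}).

Lemma Rintegral_dominated_cvg (f_ : (Y -> R)^nat) (f g : Y -> R) :
  (forall k, measurable_fun setT (f_ k)) -> measurable_fun setT f ->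
  (forall x, f_ k x @[k --> \oo] --> f x) ->
  m.-integrable setT (EFin \o g) -> (forall k x, `|f_ k x| <= g x) ->
  \int[m]_x f_ k x @[k --> \oo] --> \int[m]_x f x.
Proof.
move=> mf_ mf cf ig fg.
have cf' x : setT x -> (f_ k x)%:E @[k --> \oo] --> (f x)%:E.
  by move=> _; apply: cvg_EFin; [exact: nearW|exact: cf].
have [intf _ cv] := @dominated_convergence _ _ _ m _ measurableT
  (fun k x => (f_ k x)%:E) (EFin \o f) (EFin \o g)
  (fun k => (measurable_EFinP _ _).2 (mf_ k)) ((measurable_EFinP _ _).2 mf)
  (aeW _ cf') ig
  (aeW _ (fun x k _ => fg k x)).
apply: fine_cvg; rewrite fineK//; exact: integrable_fin_num.
Qed.

Lemma eq_Rintegral_ae (f g : Y -> R) : measurable_fun setT f ->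
  measurable_fun setT g -> {ae m, forall x, f x = g x} ->
  \int[m]_x f x = \int[m]_x g x.
Proof.
move=> mf mg fg; congr fine; apply: ae_eq_integral => //.
- exact/measurable_EFinP.
- exact/measurable_EFinP.
- by apply: filterS fg => x -> _.
Qed.

Lemma Rintegral_ge0_eq0_ae (f : Y -> R) : m.-integrable setT (EFin \o f) ->
  (forall x, 0 <= f x) -> \int[m]_x f x = 0 -> {ae m, forall x, f x = 0}.
Proof.
move=> intf f0 If0; have mf := measurable_int m intf.
have : (\int[m]_x `|(EFin \o f) x| = 0)%E.
  transitivity (\int[m]_x (EFin \o f) x)%E.
    by apply: eq_integral => x _; rewrite gee0_abs// lee_fin.
  by rewrite -[LHS]fineK ?[X in X%:E]If0//; exact: integrable_fin_num.
move/(ae_eq_integral_abs m measurableT mf).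
by apply: filterS => x /(_ I)[].
Qed.

End Rintegral_facts.

Section pairing.
Context {R : realType} {n : nat}.

Notation mu := (@lebesgue_rV R n).
Notation T := (lebesgue_rVType R n).
Implicit Types (a b v : 'rV[R]_n) (K : R) (f psi : 'rV[R]_n -> R).

Lemma ae_imply (P Q : 'rV[R]_n -> Prop) : (forall x, P x -> Q x) ->
  {ae mu, forall x, P x} -> {ae mu, forall x, Q x}.
Proof.
by move=> PQ; apply: (@filterS _ _ (ae_filter_ringOfSetsType mu)) => x; exact: PQ.
Qed.

Lemma ae_imply2 (P Q S : 'rV[R]_n -> Prop) : (forall x, P x -> Q x -> S x) ->
  {ae mu, forall x, P x} -> {ae mu, forall x, Q x} -> {ae mu, forall x, S x}.
Proof.
move=> PQS; apply: (@filterS2 _ _ (ae_filter_ringOfSetsType mu)) => x.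
exact: PQS.
Qed.

(** Boxes stand in for compact sets, because their images under translations
and dilations are again boxes. *)
Definition locint f := measurable_fun setT (f : T -> R) /\
  forall a b, mu.-integrable (obox a b) (EFin \o (f : T -> R)).

Definition tame K a b psi := measurable_fun setT (psi : T -> R) /\
  forall x, `|psi x| <= K * \1_(obox a b) x.

Definition pairing f psi : R := \int[mu]_x (f x * psi x).

Lemma Lloc1_locint f : Lloc1 f -> locint f.
Proof.
move=> [mf Kf]; split=> // a b.
apply/integrableP; split; first exact/measurable_EFinP/measurable_funTS.
apply: le_lt_trans (Kf _ (@compact_cbox _ _ a b)).
apply: ge0_subset_integral => //.
- exact: measurable_obox.
- apply: borel_measurable_completed.
  exact: (measurable_borel_box (fun i => measurable_itv `[a 0 i, b 0 i])).
- apply/measurable_EFinP/measurable_funTS.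
  exact: (measurableT_comp (@normr_measurable R setT) mf).
- by move=> x xab i; exact/subset_itv_oo_cc/xab.
Qed.

Lemma locint_norm f : locint f -> locint (fun x => `|f x|).
Proof.
move=> [mf intf]; split=> [|a b]; last exact: (integrable_norm (intf a b)).
exact: (measurableT_comp (@normr_measurable R setT) mf).
Qed.

Lemma locint_cst (r : R) : locint (cst r).
Proof.
split=> // a b; apply: measurable_bounded_integrable => //.
- exact: measurable_obox.
- exact: lebesgue_rV_obox_lty.
- exact: bounded_cst.
Qed.

Lemma tame_ge0 K a b psi x : tame K a b psi -> 0 <= K * \1_(obox a b) x.
Proof. by move=> [_ /(_ x)]; exact: le_trans. Qed.

Lemma integrable_pairing K a b f psi : locint f -> tame K a b psi ->
  mu.-integrable setT (EFin \o (fun x : T => f x * psi x)).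
Proof.
move=> [mf intf] [mpsi psiK].
have mfpsi : measurable_fun setT (fun x : T => f x * psi x) by exact: measurable_funM.
have mQ := measurable_obox a b.
have : mu.-integrable (obox a b) (EFin \o (fun x : T => f x * psi x)).
  apply: (@le_integrable _ _ _ mu _ mQ _ (fun x => `|K|%:E * `|f x|%:E)%E).
  - exact/measurable_EFinP/measurable_funTS.
  - move=> x Qx; rewrite /= lee_fin [leRHS]ger0_norm ?mulr_ge0// normrM mulrC.
    rewrite ler_wpM2r// (le_trans (psiK x))// indicE mem_set// mulr1.
    exact: ler_norm.
  - apply: integrableZl => //; exact: (integrable_norm (intf a b)).
move/(integrable_mkcond _ mQ).
rewrite (_ : _ \_ _ = EFin \o (fun x : T => f x * psi x))//.
apply/funext => x; rewrite patchE; case: ifPn => // /negP xQ.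
have := psiK x; rewrite indicE memNset; last by move=> /mem_set.
by rewrite mulr0 normr_le0 => /eqP /= ->; rewrite mulr0.
Qed.

Lemma tameB K L a b psi phi : tame K a b psi -> tame L a b phi ->
  tame (K + L) a b (fun x => psi x - phi x).
Proof.
move=> [mpsi psiK] [mphi phiL]; split; first exact: measurable_funB.
by move=> x; rewrite mulrDl (le_trans (ler_normB _ _))// lerD.
Qed.

Lemma pairingB K L a b f psi phi : locint f -> tame K a b psi ->
  tame L a b phi ->
  pairing f (fun x => psi x - phi x) = pairing f psi - pairing f phi.
Proof.
move=> lf tpsi tphi; rewrite /pairing -RintegralB//.
- by apply: eq_Rintegral => x _; rewrite mulrBr.
- exact: (integrable_pairing lf tpsi).
- exact: (integrable_pairing lf tphi).
Qed.

Lemma tame_norm K a b psi : tame K a b psi -> tame K a b (fun x => `|psi x|).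
Proof.
move=> [mpsi psiK]; split=> [|x]; last by rewrite normr_id.
exact: (measurableT_comp (@normr_measurable R setT) mpsi).
Qed.

Lemma le_normr_pairing K a b f psi : locint f -> tame K a b psi ->
  `|pairing f psi| <= pairing (fun x => `|f x|) (fun x => `|psi x|).
Proof.
move=> lf tpsi; rewrite /pairing.
apply: (le_trans (le_normr_Rintegral _ (integrable_pairing lf tpsi))) => //.
by rewrite le_eqVlt; apply/orP; left; apply/eqP/eq_Rintegral => x _; rewrite normrM.
Qed.

Lemma pairing_cvg K a b f (psi_ : ('rV[R]_n -> R)^nat) psi : locint f ->
  (forall k, tame K a b (psi_ k)) -> tame K a b psi ->
  (forall x, psi_ k x @[k --> \oo] --> psi x) ->
  pairing f (psi_ k) @[k --> \oo] --> pairing f psi.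
Proof.
move=> lf tpsi_ tpsi cpsi.
apply: (@Rintegral_dominated_cvg _ T _ mu _ _ (fun x => `|f x| * (K * \1_(obox a b) x))).
- by move=> k; apply: measurable_funM; [exact: lf.1|exact: (tpsi_ k).1].
- by apply: measurable_funM; [exact: lf.1|exact: tpsi.1].
- by move=> x; apply: cvgMr; exact: cpsi.
- apply: (@integrable_pairing K a b _ _ (locint_norm lf)); split.
    have mI : measurable_fun setT (\1_(obox a b) : T -> R).
      by apply: measurable_indic; exact: measurable_obox.
    exact: (measurable_funM (measurable_cst K) mI).
  by move=> x; rewrite ger0_norm//; exact: tame_ge0 tpsi.
- by move=> k x; rewrite normrM ler_wpM2l//; exact: (tpsi_ k).2.
Qed.

Lemma tame_indic a b (A : set T) : measurable A -> A `<=` obox a b ->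
  tame 1 a b \1_A.
Proof.
move=> mA AQ; split=> [|x]; first exact: measurable_indic.
rewrite mul1r !indicE normr_nat ler_nat.
by case: (boolP (x \in A)) => //; rewrite inE => /AQ xQ; rewrite mem_set.
Qed.

Lemma tame_window c a b chi : 0 < c -> windows c a b chi ->
  exists2 K, 0 <= K & tame K a b (tensor chi).
Proof.
move=> c0 w; have [K K0 KP] := tensor_bounded c0 w; exists K => //.
split=> [|x]; first exact: measurable_tensor w.
rewrite indicE; have [xQ|xQ] := pselect (obox a b x).
  by rewrite mem_set// mulr1.
by rewrite memNset// mulr0 (tensor_eq0 w xQ) normr0.
Qed.

Lemma tame_bump c a b : 0 < c -> tame 1 a b (bump c a b).
Proof.
move=> c0; split=> [|x]; first exact: measurable_tensor (@windows_bump1 _ _ _ _ _).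
have /andP[b0 b1] := bump_itv01 a b x c0.
rewrite mul1r indicE; have [xQ|xQ] := pselect (obox a b x).
  by rewrite mem_set// ger0_norm.
by rewrite memNset// /bump (tensor_eq0 (@windows_bump1 _ _ c a b) xQ) normr0.
Qed.

(** Bumps converge boundedly to the indicator of a box, and from boxes the
pi-lambda theorem reaches all bounded measurable sets. This is how identities
between integrals pass from test functions to sets. *)
Lemma indic_ind a b (P : ('rV[R]_n -> R) -> Prop) :
  (forall c a' b', 0 < c -> obox a' b' `<=` obox a b -> P (bump c a' b')) ->
  (forall psi phi, tame 1 a b psi -> tame 1 a b phi -> P psi -> P phi ->
    P (fun x => psi x - phi x)) ->
  (forall (psi_ : ('rV[R]_n -> R)^nat) psi, (forall k, tame 1 a b (psi_ k)) ->
    tame 1 a b psi -> (forall x, psi_ k x @[k --> \oo] --> psi x) ->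
    (forall k, P (psi_ k)) -> P psi) ->
  (forall psi phi, tame 1 a b psi -> tame 1 a b phi ->
    {ae mu, forall x, psi x = phi x} -> P psi -> P phi) ->
  forall A : set T, measurable A -> A `<=` obox a b -> P \1_A.
Proof.
move=> Pbump PB Pcvg Pae; apply: obox_ind.
- move=> a' b' Q'Q; apply: (Pcvg (fun k => bump k.+1%:R^-1 a' b')).
  + move=> k; have [m h] := @tame_bump k.+1%:R^-1 a' b' (ltac:(by rewrite invr_gt0)).
    split=> // x; apply: le_trans (h x) _; rewrite !mul1r !indicE ler_nat.
    by case: (boolP (x \in obox a' b')) => //; rewrite inE => /Q'Q xQ; rewrite mem_set.
  + by apply: tame_indic => //; exact: measurable_obox.
  + exact: cvg_bump.
  + by move=> k; apply: Pbump => //; rewrite invr_gt0.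
- move=> A B mA mB BA AQ PA PB'.
  have tA := tame_indic mA AQ; have tB := tame_indic mB (subset_trans BA AQ).
  rewrite (_ : \1_(A `\` B) = fun x => \1_A x - \1_B x); first exact: PB.
  apply/funext => x; rewrite !indicE in_setD.
  case: (boolP (x \in B)) => [|xB]; last by rewrite andbT subr0.
  by rewrite inE => /BA xA; rewrite mem_set//= subrr.
- move=> A mA AQ ndA PA; apply: (Pcvg (fun k => \1_(A k))) => //.
  + by move=> k; exact: tame_indic.
  + by apply: tame_indic; [exact: bigcupT_measurable|exact: bigcup_sub].
  + move=> x; have [[k _ Akx]|nx] := pselect ((\bigcup_k A k) x).
      rewrite [X in _ --> X]indicE mem_set; last by exists k.
      apply: cvg_near_cst; exists k => // l /= kl; rewrite indicE mem_set//.
      by move: kl => /ndA/subsetPset; exact.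
    rewrite [X in _ --> X]indicE memNset//; apply: cvg_near_cst.
    apply: nearW => k; rewrite indicE memNset// => Akx; apply: nx.
    by exists k.
- move=> A B mA mB BA AQ AB0; apply: Pae; [| |exists (A `\` B); split => //].
  + exact: tame_indic mB (subset_trans BA AQ).
  + exact: tame_indic.
  + exact: measurableD.
  + move=> x /= ne; apply: contrapT => nAB; apply: ne.
    rewrite !indicE; congr (_%:R); congr nat_of_bool.
    apply/idP/idP; rewrite !inE; first exact: BA.
    by move=> Ax; apply: contrapT => Bx; apply: nAB.
Qed.

(** Take for A the bounded parts of the sets where f >= 0 and where f <= 0. *)
Lemma locint_ae_eq0 f : locint f ->
  (forall k (A : set T), measurable A -> A `<=` cube k -> pairing f \1_A = 0) ->
  {ae mu, forall x, f x = 0}.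
Proof.
move=> lf h; have mf := lf.1.
have key k (A : set T) : measurable A ->
    (forall x, A x -> 0 <= f x) \/ (forall x, A x -> 0 <= - f x) ->
    {ae mu, forall x, (A `&` cube k) x -> f x = 0}.
  move=> mA sA; set B := A `&` cube k.
  have mB : measurable B by apply: measurableI => //; exact: measurable_obox.
  have tB : tame 1 _ _ \1_B := tame_indic mB (@subIsetr _ _ _).
  have iB := integrable_pairing lf tB; have hB := h k B mB (@subIsetr _ _ _).
  have : {ae mu, forall x, f x * \1_B x = 0}.
    case: sA => sA.
      apply: Rintegral_ge0_eq0_ae => // x; rewrite indicE.
      by case: (boolP (x \in B)); rewrite ?mulr0// mulr1 inE => -[/sA].
    have : {ae mu, forall x, - (f x * \1_B x) = 0}.
      apply: Rintegral_ge0_eq0_ae.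
      - rewrite (_ : _ \o _ = -%E \o (EFin \o (fun x : T => f x * \1_B x))%R).
          exact: integrableN.
        by apply/funext => x /=.
      - move=> x; rewrite indicE -mulNr.
        by case: (boolP (x \in B)); rewrite ?mulr0// mulr1 inE => -[/sA].
      - under eq_Rintegral do rewrite -mulN1r.
        by rewrite RintegralZl// [X in _ * X]hB mulr0.
    by apply: ae_imply => x /eqP; rewrite oppr_eq0 => /eqP.
  apply: ae_imply => x + Bx; by rewrite indicE mem_set// mulr1.
have m0 : measurable [set x : T | 0 <= f x].
  rewrite (_ : mkset _ = f @^-1` `[0, +oo[).
    by rewrite -[X in measurable X]setTI; exact: mf.
  by apply/seteqP; split => x /=; rewrite in_itv/= andbT.
have m0' : measurable [set x : T | 0 <= - f x].
  rewrite (_ : mkset _ = f @^-1` `]-oo, 0]).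
    by rewrite -[X in measurable X]setTI; exact: mf.
  by apply/seteqP; split => x /=; rewrite in_itv/= oppr_ge0.
have k1 : {ae mu, forall x k, ([set x | 0 <= f x] `&` cube k) x -> f x = 0}.
  by apply/ae_foralln => k; apply: key => //; left.
have k2 : {ae mu, forall x k, ([set x | 0 <= - f x] `&` cube k) x -> f x = 0}.
  by apply/ae_foralln => k; apply: key => //; right.
apply: ae_imply2 k1 k2 => x h1 h2.
have : (\bigcup_k cube k) x by rewrite bigcup_cube.
move=> [k _ xk]; have [f0|f0] := leP 0 (f x); first by apply: (h1 k).
by apply: (h2 k); split => //=; rewrite oppr_ge0 ltW.
Qed.

(** The fundamental lemma of the calculus of variations; bumps suffice as test
functions. *)
Lemma fundamental_lemma f : locint f ->
  (forall c a b, 0 < c -> pairing f (bump c a b) = 0) ->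
  {ae mu, forall x, f x = 0}.
Proof.
move=> lf h; apply: locint_ae_eq0 => // k.
apply: (@indic_ind _ _ (fun psi => pairing f psi = 0)).
- by move=> c a' b' c0 _; exact: h.
- by move=> psi phi t1 t2 e1 e2; rewrite (pairingB lf t1 t2) e1 e2 subrr.
- move=> psi_ psi tpsi_ tpsi cpsi e.
  have /cvg_lim <- // := pairing_cvg lf tpsi_ tpsi cpsi.
  by under eq_fun do rewrite e; rewrite lim_cst.
- move=> psi phi t1 t2 ae <-; apply: eq_Rintegral_ae.
  + by apply: measurable_funM; [exact: lf.1|exact: t2.1].
  + by apply: measurable_funM; [exact: lf.1|exact: t1.1].
  + by apply: ae_imply ae => x ->.
Qed.

End pairing.

(** * Differentiation along translations *)

Section derivative_limit.
Context {R : realType}.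
Implicit Types (r L t : R) (f g : R -> R).

Lemma lipschitz_of_derive f g r L : (forall t, is_derive t 1 f (g t)) ->
  (forall t, `|t| <= r -> `|g t| <= L) ->
  forall s t, `|s| <= r -> `|t| <= r -> `|f t - f s| <= L * `|t - s|.
Proof.
move=> df gL.
have key s t : s <= t -> `|s| <= r -> `|t| <= r -> `|f t - f s| <= L * `|t - s|.
  move=> st sr tr.
  have [|c] := @MVT_segment R f g s t st (fun x _ => df x).
    apply: continuous_subspaceT => x; apply/differentiable_continuous.
    by apply/derivable1_diffP; have [] := df x.
  rewrite in_itv/= => /andP[sc ct] ->; rewrite normrM ler_wpM2r// gL//.
  move: sr tr; rewrite !ler_norml => /andP[? ?] /andP[? ?].
  by apply/andP; split; lra.
move=> s t sr tr; have [st|/ltW ts] := leP s t; first exact: key.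
by rewrite distrC [in leRHS]distrC; exact: key.
Qed.

(** The mean value theorem bounds the increments of f_ l - f_ k uniformly in l;
letting l tend to infinity compares the increments of f with those of f_ k. *)
Lemma is_derive_unif_lim (f_ g_ : (R -> R)^nat) f g :
  (forall k t, is_derive t 1 (f_ k) (g_ k t)) ->
  (forall t, f_ k t @[k --> \oo] --> f t) ->
  (forall r e, 0 < e -> \forall k \near \oo, forall t, `|t| <= r ->
    `|g_ k t - g t| <= e) ->
  forall t, is_derive t 1 f (g t).
Proof.
move=> df cf ug t.
suff cv : (fun h => h^-1 *: ((f \o shift t) (h *: 1) - f t)) @ 0^' --> g t.
  by apply: DeriveDef; [apply/cvg_ex; eexists; exact: cv|exact: cvg_lim].
apply/cvgrPdist_le => e e0.
have e40 : 0 < e / 4 by lra.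
have [N _ hN] := ug (`|t| + 1) _ e40.
have dist h : `|h| <= 1 -> h != 0 ->
    `|(f (t + h) - f t) - (f_ N (t + h) - f_ N t)| <= (e / 2) * `|h|.
  move=> h1 h0.
  have cv : `|(f_ k (t + h) - f_ k t) - (f_ N (t + h) - f_ N t)| @[k --> \oo] -->
      `|(f (t + h) - f t) - (f_ N (t + h) - f_ N t)|.
    by apply: cvg_norm; apply: cvgB; [apply: cvgB; exact: cf|exact: cvg_cst].
  apply: (ler_cvg_to cv (cvg_cst _)); near=> k.
  have Nk : (N <= k)%N by near: k; exact: nbhs_infty_ge.
  have dk (s : R) : is_derive s 1 (fun s : R => f_ k s - f_ N s) (g_ k s - g_ N s).
    exact: is_deriveB.
  have := @lipschitz_of_derive _ _ (`|t| + 1) (e / 2) dk _ t (t + h).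
  rewrite [t + h - t]addrC addKr => lip.
  have -> : f_ k (t + h) - f_ k t - (f_ N (t + h) - f_ N t) =
    (f_ k (t + h) - f_ N (t + h)) - (f_ k t - f_ N t) by ring.
  apply: lip; last 2 first.
  - by rewrite lerDl.
  - by apply: le_trans (ler_normD _ _) _; rewrite lerD2l.
  move=> s sr; have := hN _ (leqnn N) _ sr; have := hN _ Nk _ sr.
  rewrite !ler_norml => /andP[? ?] /andP[? ?]; apply/andP; split; lra.
have := ex_derive (is_derive := df N t); have := derive_val (is_derive := df N t).
move=> dv /cvg_ex[l cl]; have lE : l = g_ N t by rewrite -dv; apply/esym/cvg_lim.
move: cl; rewrite lE => /cvgrPdist_le/(_ _ e40) cN.
near=> h.
have h0 : h != 0 by near: h; exact: nbhs_dnbhs_neq.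
have h1 : `|h| <= 1 by near: h; exact: dnbhs0_le.
have := hN _ (leqnn N) t; rewrite lerDl ler01 => /(_ isT).
have : `|g_ N t - h^-1 *: ((f_ N \o shift t) (h *: 1) - f_ N t)| <= e / 4.
  by near: h.
have := dist h h1 h0.
rewrite -ler_pdivrMr ?normr_gt0// -normfV -normrM /= scaler1 [h + t]addrC.
rewrite /GRing.scale/= mulrBl.
set q := h^-1 * (f (t + h) - f t); set qN := h^-1 * (f_ N (t + h) - f_ N t).
rewrite [_ * h^-1]mulrC -/q [_ * h^-1]mulrC -/qN.
rewrite !ler_norml => /andP[? ?] /andP[? ?] /andP[? ?].
by apply/andP; split; lra.
Unshelve. all: by end_near. Qed.

End derivative_limit.

Section translation.
Context {R : realType} {n : nat}.

Notation mu := (@lebesgue_rV R n).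
Notation T := (lebesgue_rVType R n).
Implicit Types (a b v : 'rV[R]_n) (K r t : R) (f psi : 'rV[R]_n -> R).

Definition translate v psi x := psi (x - v).

Lemma translateE v psi : translate v psi = psi \o affine 1 (- v).
Proof. by apply/funext => x; rewrite /translate/= /affine scale1r. Qed.

Lemma measurable_translate v psi : measurable_fun setT (psi : T -> R) ->
  measurable_fun setT (translate v psi : T -> R).
Proof.
move=> mpsi; rewrite translateE.
exact: (measurableT_comp mpsi (measurable_affine (- v) ltr01)).
Qed.

Lemma ae_affine (P : 'rV[R]_n -> Prop) s v : 0 < s ->
  {ae mu, forall x, P x} -> {ae mu, forall x, P (affine s v x)}.
Proof.
move=> s0 [A [mA A0 PA]]; have [mA' A0'] := lebesgue_rV_affine v s0 mA.
exists (affine s v @^-1` A); split => //; first by rewrite A0' A0 mule0.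
by move=> x /= Px; exact: PA.
Qed.

Lemma Rintegral_translate v psi : measurable_fun setT (psi : T -> R) ->
  \int[mu]_x translate v psi x = \int[mu]_x psi x.
Proof.
move=> mpsi; rewrite translateE (Rintegral_affine (- v) ltr01 mpsi).
by rewrite invr1 expr1n mul1r.
Qed.

Lemma tame_translate K a b v psi r : 0 <= K ->
  (forall i, `|v 0 i| <= r) -> tame K a b psi ->
  tame K (a - const_mx r) (b + const_mx r) (translate v psi).
Proof.
move=> K0 vr [mpsi psiK]; split=> [|x]; first exact: measurable_translate.
apply: le_trans (psiK (x - v)) _; rewrite ler_wpM2l// !indicE ler_nat.
case: (boolP (x - v \in obox a b)) => //; rewrite inE => xQ.
rewrite mem_set// => i; have := xQ i; have := vr i.
rewrite !in_itv/= !mxE ler_norml => /andP[? ?] /andP[? ?].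
by apply/andP; split; lra.
Qed.

(** Split f at a height m: the part of f below m is controlled by the integral
of psi, which translations preserve, and the part above m has small mass. *)
Lemma pairing_translate_cvg0 K a b f (psi_ : ('rV[R]_n -> R)^nat) r e :
  0 <= K -> locint f -> (forall k, tame K a b (psi_ k)) ->
  (forall x, psi_ k x @[k --> \oo] --> 0) -> 0 < e ->
  \forall k \near \oo, forall v, (forall i, `|v 0 i| <= r) ->
    `|pairing f (translate v (psi_ k))| <= e.
Proof.
move=> K0 lf tpsi cpsi e0.
set a' := a - const_mx r; set b' := b + const_mx r.
have lF := locint_norm lf.
pose high m x : R := \1_([set x | m%:R < `|f x|] `&` obox a' b') x.
have mhigh (m : nat) : measurable ([set x : T | m%:R < `|f x|] `&` obox a' b').
  apply: measurableI; last exact: measurable_obox.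
  rewrite (_ : mkset _ = (fun x => `|f x|) @^-1` `]m%:R, +oo[).
    by rewrite -[X in measurable X]setTI; exact: lF.1.
  by apply/seteqP; split => x /=; rewrite in_itv/= andbT.
have thigh m : tame 1 a' b' (high m).
  by apply: tame_indic => //; exact: subIsetr.
have t0 : tame 1 a' b' (fun=> 0).
  by split=> [|x]; [exact: measurable_cst|rewrite normr0 mul1r indicE].
have chigh : pairing (fun x => `|f x|) (high m) @[m --> \oo] --> 0.
  have -> : 0 = pairing (fun x => `|f x|) (fun=> 0).
    rewrite /pairing; under eq_Rintegral do rewrite mulr0.
    by rewrite Rintegral_cst ?mul0r.
  apply: (pairing_cvg lF thigh t0) => x; apply: cvg_near_cst.
  near=> m; rewrite /high indicE memNset// => -[/= + _]; apply/negP.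
  rewrite -leNgt ltW//.
  by near: m; exact: nbhs_infty_gtr.
have eK0 : 0 < e / 2 / (K + 1) by rewrite !divr_gt0// ltr_wpDl.
move/cvgrPdist_le : chigh => /(_ _ eK0)[m _ /(_ m (leqnn m))].
rewrite sub0r normrN => hm.
have l1 : locint (cst (1 : R) : 'rV[R]_n -> R) by exact: locint_cst.
have c1 : pairing (cst 1) (fun x => `|psi_ k x|) @[k --> \oo] --> 0.
  have -> : 0 = pairing (cst (1 : R) : 'rV[R]_n -> R) (fun=> 0).
    rewrite /pairing; under eq_Rintegral do rewrite mulr0.
    by rewrite Rintegral_cst ?mul0r.
  have tn k := tame_norm (tpsi k).
  have t0' : tame K a b (fun=> 0).
    split=> [|x]; first exact: measurable_cst.
    by rewrite normr0; exact: tame_ge0 (tpsi 0%N).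
  apply: (pairing_cvg l1 tn t0') => x; rewrite -(normr0 R).
  exact: cvg_norm (cpsi x).
have em0 : 0 < e / 2 / m.+1%:R by rewrite !divr_gt0.
have /cvgrPdist_le/(_ _ em0) c1' := c1.
near=> k => v vr.
have tv := tame_translate K0 vr (tpsi k); rewrite -/a' -/b' in tv.
have tnv := tame_norm tv.
apply: (le_trans (le_normr_pairing lf tv)).
have int1 := integrable_pairing l1 tnv.
have inth := integrable_pairing lF (thigh m).
apply: (@le_trans _ _ (m.+1%:R * pairing (cst 1) (fun x => `|translate v (psi_ k) x|) +
    K * pairing (fun x => `|f x|) (high m))).
  rewrite /pairing -(RintegralZl _ measurableT int1) -(RintegralZl _ measurableT inth).
  have intZ1 := integrableZl measurableT m.+1%:R int1.
  have intZ2 := integrableZl measurableT K inth.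
  rewrite -RintegralD//; apply: le_Rintegral => //.
  - exact: integrable_pairing lF tnv.
  - exact: (integrableD measurableT intZ1 intZ2).
  move=> x _; rewrite mul1r.
  have := tv.2 x; rewrite /high indicE.
  have [xQ|xQ] := pselect (obox a' b' x).
    rewrite mem_set// mulr1 => pK; have [fm|fm] := leP `|f x| m%:R.
      rewrite -[leLHS]addr0 lerD//.
        rewrite ler_wpM2r// (le_trans fm)// ler_nat//.
      by rewrite indicE !mulr_ge0.
    rewrite indicE mem_set// mulr1 -[leLHS]add0r lerD//.
    by rewrite mulrC ler_wpM2r.
  rewrite memNset// mulr0 normr_le0 => /eqP ->.
  by rewrite normr0 !mulr0 add0r !mulr_ge0.
rewrite [leRHS](splitr e) lerD//; last first.
  apply: (@le_trans _ _ ((K + 1) * (e / 2 / (K + 1)))).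
    rewrite ler_pM ?lerDl//; last by rewrite (le_trans (ler_norm _)).
    by apply: Rintegral_ge0 => x _; rewrite mulr_ge0// /high indicE.
  by rewrite mulrC divfK// gt_eqF// ltr_wpDl.
rewrite -ler_pdivlMl//.
apply: (@le_trans _ _ (e / 2 / m.+1%:R)); last by rewrite mulrC.
have -> : pairing (cst 1) (fun x => `|translate v (psi_ k) x|) =
    pairing (cst 1) (fun x => `|psi_ k x|).
  rewrite /pairing; under eq_Rintegral do rewrite mul1r.
  under [RHS]eq_Rintegral do rewrite mul1r.
  exact: (Rintegral_translate v (tame_norm (tpsi k)).1).
apply: le_trans (ler_norm _) _; rewrite -normrN -sub0r.
by near: k.
Unshelve. all: by end_near. Qed.

End translation.

(** * Weak partial derivatives *)

Section weak_partial.
Context {R : realType} {n : nat}.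

Notation mu := (@lebesgue_rV R n).
Notation T := (lebesgue_rVType R n).
Implicit Types (a b v x : 'rV[R]_n) (c K r t : R) (w d psi : 'rV[R]_n -> R).

(** Products of windows serve as test functions: they are stable under
translation and rich enough to separate locally integrable functions. *)
Definition weak_partial (i : 'I_n) w d := [/\ locint w, locint d &
  forall c a b chi, 0 < c -> windows c a b chi ->
    pairing w (tensor (derive_at i chi)) = - pairing d (tensor chi)].

Lemma weak_gradient_partial w D i : is_weak_gradient w D ->
  weak_partial i w (fun x => D x 0 i).
Proof.
move=> [lw /(_ i)[ld h]]; split; [exact: Lloc1_locint..|].
move=> c a b chi c0 wchi.
by rewrite -(h _ (test_function_tensor c0 wchi)) (pderiv_tensor i c0 wchi).
Qed.

Section direction.
Variable i : 'I_n.

Definition slide t psi := translate (t *: delta_mx 0 i) psi.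

Lemma slide_bound t r j : `|t| <= r -> `|(t *: delta_mx 0 i : 'rV[R]_n) 0 j| <= r.
Proof.
move=> tr; rewrite !mxE eqxx/=; case: eqP => _; rewrite ?mulr1// mulr0 normr0.
exact: le_trans tr.
Qed.

Lemma tame_slide K a b psi t r : 0 <= K -> `|t| <= r -> tame K a b psi ->
  tame K (a - const_mx r) (b + const_mx r) (slide t psi).
Proof. by move=> K0 tr; apply: tame_translate => // j; exact: slide_bound. Qed.

Lemma derive_at_shift1 c a b chi t : 0 < c -> windows c a b chi ->
  derive_at i (shift1 i t chi) = shift1 i t (derive_at i chi).
Proof.
move=> c0 w; apply/funext => j; apply/funext => s.
rewrite /derive_at /shift1; case: eqP => // _.
have [dchi _] := window_derive c0 (w j).
have d1 : is_derive s 1 (fun s : R => s - t) 1.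
  by apply: is_derive_eq; rewrite subr0.
rewrite derive1E.
have := @is_derive1_comp _ (chi j) (fun s => s - t) s _ _
  (derivableP (dchi (s - t))) d1.
by rewrite mulr1 derive1E => -[].
Qed.

Lemma is_derive_slide_tensor c a b chi t x : 0 < c -> windows c a b chi ->
  is_derive t 1 (fun t => slide t (tensor chi) x)
    (- slide t (tensor (derive_at i chi)) x).
Proof.
move=> c0 w; have [dchi _] := window_derive c0 (w i).
pose C := \prod_(j | j != i) chi j (x 0 j).
have eC s : slide s (tensor chi) x = C * chi i (x 0 i - s).
  rewrite /slide /translate /tensor (bigD1 i)//= mulrC; congr (_ * _).
    by apply: eq_bigr => j /negPf ji; rewrite !mxE ji andbF mulr0 subr0.
  by rewrite !mxE !eqxx mulr1.
have eC' : slide t (tensor (derive_at i chi)) x = C * derive1 (chi i) (x 0 i - t).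
  rewrite /slide /translate /tensor (bigD1 i)//= mulrC; congr (_ * _).
    apply: eq_bigr => j /negPf ji; rewrite /derive_at ji.
    by rewrite !mxE ji andbF mulr0 subr0.
  by rewrite /derive_at !mxE !eqxx mulr1.
rewrite eC' (_ : (fun _ => _) = fun s => C * chi i (x 0 i - s)); last exact/funext.
have d1 : is_derive t 1 (fun s : R => x 0 i - s) (- 1).
  have := is_deriveB (is_derive_cst (x 0 i) t 1) (is_derive_id t 1).
  by rewrite sub0r.
have d2 := @is_derive1_comp _ (chi i) (fun s => x 0 i - s) t _ _
  (derivableP (dchi (x 0 i - t))) d1.
have := @is_deriveZ _ _ _ (chi i \o (fun s => x 0 i - s)) C t 1 _ d2.
by rewrite mulrN1 -derive1E scalerN.
Qed.

(** Differentiate under the integral sign: sliding a test function produces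
minus its partial derivative, and integration by parts absorbs the sign. *)
Lemma is_derive_pairing_tensor w d c a b chi : weak_partial i w d -> 0 < c ->
  windows c a b chi -> forall t,
  is_derive t 1 (fun t => pairing w (slide t (tensor chi)))
    (pairing d (slide t (tensor chi))).
Proof.
move=> [lw ld ibp] c0 wchi t.
have wd := windows_derive_at i c0 wchi.
have [K K0 tchi] := tame_window c0 wchi.
have [L L0 tdchi] := tame_window c0 wd.
pose f (s : R) (x : T) : R := w x * slide s (tensor chi) x.
have df (s : R) x : is_derive s 1 (f ^~ x)
    (- (w x * slide s (tensor (derive_at i chi)) x)).
  have := @is_deriveZ _ _ _ (fun s => slide s (tensor chi) x) (w x) s 1 _
    (is_derive_slide_tensor s x c0 wchi).
  by rewrite scalerN.
set a' := a - const_mx (`|t| + 1); set b' := b + const_mx (`|t| + 1).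
have It : [set` `]t - 1, t + 1[] t.
  by rewrite /= in_itv/=; apply/andP; split; lra.
have Ir s : [set` `]t - 1, t + 1[] s -> `|s| <= `|t| + 1.
  rewrite /= in_itv/= => /andP[h1 h2].
  have := ler_norm t; have := ler_norm (- t); rewrite normrN.
  by rewrite ler_norml => ? ?; apply/andP; split; lra.
have tG : tame L a' b' (fun x => L * \1_(obox a' b') x).
  split=> [|x].
    have mI : measurable_fun setT (\1_(obox a' b') : T -> R).
      by apply: measurable_indic; exact: measurable_obox.
    exact: (measurable_funM (measurable_cst L) mI).
  by rewrite ger0_norm// mulr_ge0// indicE.
pose G (x : T) : R := `|w x| * (L * \1_(obox a' b') x).
have intG : mu.-integrable setT (EFin \o G).
  exact: (integrable_pairing (locint_norm lw) tG).
have intf s : [set` `]t - 1, t + 1[] s -> mu.-integrable setT (EFin \o f s).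
  by move=> /Ir sr; exact: (integrable_pairing lw (tame_slide K0 sr tchi)).
have derf s x : [set` `]t - 1, t + 1[] s -> setT x -> derivable (f ^~ x) s 1.
  by move=> _ _; have [] := df s x.
have G0 x : 0 <= G x by rewrite /G !mulr_ge0// indicE.
have fG s x : [set` `]t - 1, t + 1[] s -> setT x -> `|partial1of2 f s x| <= G x.
  move=> /Ir sr _; rewrite partial1of2E (derive_val (is_derive := df s x)).
  rewrite normrN normrM ler_wpM2l//.
  exact: (tame_slide L0 sr tdchi).2.
have D1 := @derivable_under_integral R _ T mu f setT measurableT t _ _ It intf derf
  G G0 intG fG.
have D2 := @differentiation_under_integral R _ T mu f setT measurableT t _ _ It intf derf
  G G0 intG fG.
apply: DeriveDef; first exact: D1.
rewrite -derive1E; apply: etrans D2 _.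
transitivity (- pairing w (slide t (tensor (derive_at i chi)))).
  rewrite /pairing -mulN1r -RintegralZl//; last first.
    exact: (integrable_pairing lw (tame_slide L0 (Ir _ It) tdchi)).
  apply: eq_Rintegral => x _.
  by rewrite partial1of2E (derive_val (is_derive := df t x)) mulN1r.
have -> : slide t (tensor (derive_at i chi)) = tensor (derive_at i (shift1 i t chi)).
  by rewrite (derive_at_shift1 t c0 wchi); apply/funext => x; rewrite tensor_shift1.
rewrite (ibp _ _ _ _ c0 (windows_shift1 i t wchi)) opprK; congr pairing.
by apply/funext => x; rewrite tensor_shift1.
Qed.

Lemma pairing_slide_cvg a b K f (psi_ : ('rV[R]_n -> R)^nat) psi t : 0 <= K ->
  locint f -> (forall k, tame K a b (psi_ k)) -> tame K a b psi ->
  (forall x, psi_ k x @[k --> \oo] --> psi x) ->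
  pairing f (slide t (psi_ k)) @[k --> \oo] --> pairing f (slide t psi).
Proof.
move=> K0 lf tpsi_ tpsi cpsi; apply: pairing_cvg => //.
- by move=> k; exact: (tame_slide K0 (lexx _)).
- exact: (tame_slide K0 (lexx _)).
- by move=> x; exact: cpsi.
Qed.

(** The formula passes from bumps to bounded pointwise limits because the
candidate derivatives converge uniformly for bounded t. *)
Lemma is_derive_pairing_indic w d a b (A : set T) : weak_partial i w d ->
  measurable A -> A `<=` obox a b -> forall t,
  is_derive t 1 (fun t => pairing w (slide t \1_A)) (pairing d (slide t \1_A)).
Proof.
move=> wd; have [lw ld _] := wd.
apply: (@indic_ind _ _ a b (fun psi => forall t,
  is_derive t 1 (fun t => pairing w (slide t psi)) (pairing d (slide t psi)))).
- move=> c a' b' c0 _ t.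
  exact: (is_derive_pairing_tensor wd c0 (@windows_bump1 _ _ c a' b')).
- move=> psi phi t1 t2 d1 d2 t.
  have ts s := tame_slide ler01 (lexx `|s|) t1.
  have ts' s := tame_slide ler01 (lexx `|s|) t2.
  rewrite (_ : (fun _ => _) = fun s => pairing w (slide s psi) - pairing w (slide s phi)).
    rewrite (_ : pairing d _ = pairing d (slide t psi) - pairing d (slide t phi)).
      exact: is_deriveB.
    exact: (pairingB ld (ts t) (ts' t)).
  by apply/funext => s; exact: (pairingB lw (ts s) (ts' s)).
- move=> psi_ psi tpsi_ tpsi cpsi dpsi_.
  apply: (is_derive_unif_lim dpsi_).
    by move=> t; exact: (pairing_slide_cvg ler01 lw tpsi_ tpsi cpsi).
  move=> r e e0.
  have tB k := tameB (tpsi_ k) tpsi.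
  have cB x : (psi_ k x - psi x) @[k --> \oo] --> (0 : R).
    by rewrite -(subrr (psi x)); apply: cvgB; [exact: cpsi|exact: cvg_cst].
  have K0 : 0 <= 1 + 1 :> R by rewrite addr_ge0.
  have := pairing_translate_cvg0 r K0 ld tB cB e0.
  apply: filterS => k hk t tr.
  have := hk (t *: delta_mx 0 i) (fun j => slide_bound j tr).
  have -> : pairing d (translate (t *: delta_mx 0 i) (fun x => psi_ k x - psi x)) =
      pairing d (slide t (psi_ k)) - pairing d (slide t psi).
    exact: (pairingB ld (tame_slide ler01 (lexx `|t|) (tpsi_ k))
      (tame_slide ler01 (lexx `|t|) tpsi)).
  by [].
- move=> psi phi t1 t2 ae dpsi t.
  have eq f s : locint f -> pairing f (slide s psi) = pairing f (slide s phi).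
    move=> lf; apply: eq_Rintegral_ae.
    + by apply: measurable_funM; [exact: lf.1|exact: measurable_translate t1.1].
    + by apply: measurable_funM; [exact: lf.1|exact: measurable_translate t2.1].
    have := ae_affine (- (s *: delta_mx 0 i)) ltr01 ae.
    by apply: ae_imply => x; rewrite /slide /translate /affine scale1r => ->.
  rewrite -(eq d t ld) (_ : (fun _ => _) = fun s => pairing w (slide s psi)) //.
  by apply/funext => s; rewrite (eq w s lw).
Qed.

(** If A lies in the zero set of w >= 0, the integral of w over the moving set
is minimal at its initial position, so its derivative vanishes there. *)
Lemma weak_partial_eq0 w d : weak_partial i w d -> (forall x, 0 <= w x) ->
  {ae mu, forall x, w x = 0 -> d x = 0}.
Proof.
move=> wd w0; have [lw ld _] := wd.
pose Z : set T := [set x | w x = 0].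
have mZ : measurable Z.
  rewrite (_ : Z = w @^-1` [set 0])//.
  by rewrite -[X in measurable X]setTI; exact: lw.1.
have mI : measurable_fun setT (\1_Z : T -> R) by exact: measurable_indic.
have ldZ : locint (fun x => d x * \1_Z x).
  split; first exact: (measurable_funM ld.1 mI).
  move=> a b; apply: (@le_integrable _ _ _ mu _ (measurable_obox a b) _ (EFin \o d)).
  - apply/measurable_EFinP/measurable_funTS; exact: (measurable_funM ld.1 mI).
  - move=> x _; rewrite /= lee_fin normrM ler_piMr// indicE normr_nat.
    by case: (_ \in _).
  - exact: ld.2.
have : {ae mu, forall x, d x * \1_Z x = 0}.
  apply: locint_ae_eq0 => // k A mA Ak; set B := A `&` Z.
  have mB : measurable B by exact: measurableI.
  have Bk : B `<=` cube k by move=> x [/Ak].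
  have -> : pairing (fun x => d x * \1_Z x) \1_A = pairing d (slide 0 \1_B).
    apply: eq_Rintegral => x _; rewrite /slide /translate scale0r subr0.
    by rewrite /B indicI /= -mulrA [\1_Z x * _]mulrC.
  have dB := is_derive_pairing_indic wd mB Bk.
  rewrite -(derive_val (is_derive := dB 0)).
  have : is_derive (0 : R) 1 (fun t => pairing w (slide t \1_B)) 0.
    apply: (@derive1_at_min _ _ (- 1) 1).
    - by lra.
    - by move=> t _; have [] := dB t.
    - by rewrite in_itv/=; apply/andP; split; lra.
    - move=> t _; apply: (@le_trans _ _ 0); last first.
        by apply: Rintegral_ge0 => x _; rewrite mulr_ge0// /slide /translate indicE.
      rewrite le_eqVlt; apply/orP; left; apply/eqP.
      rewrite /pairing; under eq_Rintegral => x _.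
        rewrite (_ : _ * _ = 0); first over.
        rewrite /slide /translate scale0r subr0 indicE.
        case: (boolP (x \in B)); last by rewrite mulr0.
        by rewrite inE => -[_ ->]; rewrite mul0r.
      by rewrite Rintegral_cst// mul0r.
  by case.
by apply: ae_imply => x + wx0; rewrite indicE mem_set// mulr1.
Qed.

(** The integral of w over a moving set has zero derivative, so it takes the
same value at the times 0 and 1, for every bounded set. *)
Lemma weak_partial0_translate w d : weak_partial i w d ->
  {ae mu, forall x, d x = 0} -> {ae mu, forall x, w (x + delta_mx 0 i) = w x}.
Proof.
move=> wd d0; have [lw ld _] := wd.
have wE : (fun x => w (x + delta_mx 0 i)) = translate (- delta_mx 0 i) w.
  by apply/funext => x; rewrite /translate opprK.
have lw' : locint (fun x => w (x + delta_mx 0 i)).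
  split; first by rewrite wE; exact: (measurable_translate _ lw.1).
  move=> a b.
  have := integrable_affine (delta_mx 0 i) ltr01
    (measurable_obox (a + delta_mx 0 i) (b + delta_mx 0 i)) lw.1 (lw.2 _ _).
  rewrite preimage_affine_obox// invr1 !scale1r !addrK.
  rewrite (_ : w \o _ = (fun x => w (x + delta_mx 0 i)))//.
  by apply/funext => x; rewrite /= /affine scale1r.
have lB : locint (fun x => w (x + delta_mx 0 i) - w x).
  split; first exact: (measurable_funB lw'.1 lw.1).
  move=> a b; exact: (integrableB (measurable_obox a b) (lw'.2 a b) (lw.2 a b)).
have : {ae mu, forall x, w (x + delta_mx 0 i) - w x = 0}.
  apply: locint_ae_eq0 => // k A mA Ak.
  have dA := is_derive_pairing_indic wd mA Ak.
  have tA := tame_indic mA Ak.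
  have kA0 t : pairing d (slide t \1_A) = 0.
    rewrite /pairing -[RHS](_ : \int[mu]_x (0 : R) = 0).
      apply: eq_Rintegral_ae.
      - by apply: measurable_funM; [exact: ld.1|exact: measurable_translate tA.1].
      - exact: measurable_cst.
      - by apply: ae_imply d0 => x ->; rewrite mul0r.
    by rewrite Rintegral_cst ?mul0r.
  have cst : pairing w (slide 1 \1_A) = pairing w (slide 0 \1_A).
    apply: (@is_derive_0_is_cst _ (fun t => pairing w (slide t \1_A))) => t.
    by rewrite -(kA0 t).
  have -> : pairing (fun x => w (x + delta_mx 0 i) - w x) \1_A =
      pairing (fun x => w (x + delta_mx 0 i)) \1_A - pairing w \1_A.
    rewrite /pairing -RintegralB//.
    - by apply: eq_Rintegral => x _; rewrite mulrBl.
    - exact: (integrable_pairing lw' tA).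
    - exact: (integrable_pairing lw tA).
  have <- : pairing w (slide 0 \1_A) = pairing w \1_A.
    by congr pairing; apply/funext => x; rewrite /slide /translate scale0r subr0.
  rewrite -cst /pairing.
  have -> : \int[mu]_x (w (x + delta_mx 0 i) * \1_A x) =
      \int[mu]_x translate (- delta_mx 0 i) (fun x => w x * slide 1 \1_A x) x.
    apply: eq_Rintegral => x _; rewrite /slide /translate opprK scale1r addrK.
    by [].
  apply/eqP; rewrite subr_eq0; apply/eqP; apply: Rintegral_translate.
  by apply: measurable_funM; [exact: lw.1|exact: measurable_translate tA.1].
by apply: ae_imply => x /eqP; rewrite subr_eq0 => /eqP.
Qed.

End direction.
End weak_partial.

(** * Periodicity, sums and dilations *)

Section vanish.
Context {R : realType} {n : nat}.

Notation mu := (@lebesgue_rV R n).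
Notation T := (lebesgue_rVType R n).
Implicit Types (w d u : 'rV[R]_n -> R).

Lemma le_measure_ae (A B : set T) : measurable A -> measurable B ->
  {ae mu, forall x, A x -> B x} -> (mu A <= mu B)%E.
Proof.
move=> mA mB [N [mN N0 AB]].
apply: (@le_trans _ _ (mu (B `|` N))).
  apply: le_measure; rewrite ?inE//; first exact: measurableU.
  move=> x Ax; have [Bx|Bx] := pselect (B x); first by left.
  by right; apply: AB => /= h; apply: Bx; exact: h.
apply: (le_trans (measureU2 _ mB mN)).
by rewrite [X in (_ + X)%E](_ : _ = 0%E) ?adde0.
Qed.

(** The part of a superlevel set of |w| below a hyperplane has the same measure
for all integer heights of the hyperplane: letting the height tend to -oo and
to +oo, it is null if its measure is finite. *)
Lemma periodic_ae_eq0 (i : 'I_n) w : measurable_fun setT (w : T -> R) ->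
  {ae mu, forall x, w (x + delta_mx 0 i) = w x} ->
  (forall alpha : R, 0 < alpha -> (mu [set x | (alpha < `|w x|)%R] < +oo)%E) ->
  {ae mu, forall x, w x = 0}.
Proof.
move=> mw wper wfin.
have mlt (r : R) : measurable [set x : T | x 0 i < r].
  rewrite (_ : mkset _ = (fun x : 'rV[R]_n => x 0 i) @^-1` `]-oo, r[).
    apply: borel_measurable_completed; rewrite -[X in measurable X]setTI.
    exact: measurable_rV_coord.
  by apply/seteqP; split => x /=; rewrite in_itv.
have null (alpha : R) : 0 < alpha -> mu [set x | alpha < `|w x|] = 0%E.
  move=> alpha0; set L := [set x : T | alpha < `|w x|].
  have mL : measurable L.
    rewrite (_ : L = (fun x => `|w x|) @^-1` `]alpha, +oo[).
      rewrite -[X in measurable X]setTI.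
      exact: (measurableT_comp (@normr_measurable R setT) mw).
    by apply/seteqP; split => x /=; rewrite in_itv/= andbT.
  pose F (r : R) : set T := L `&` [set x | x 0 i < r].
  have mF r : measurable (F r) by exact: (measurableI _ _ mL (mlt r)).
  have FS r : mu (F (r + 1)) = mu (F r).
    have [mF' <-] : measurable (affine 1 (delta_mx 0 i) @^-1` F (r + 1) : set T) /\
        mu (affine 1 (delta_mx 0 i) @^-1` F (r + 1)) = mu (F (r + 1)).
      have [? ->] := lebesgue_rV_affine (delta_mx 0 i) ltr01 (mF (r + 1)).
      by rewrite invr1 expr1n mul1e.
    have E x : w (x + delta_mx 0 i) = w x ->
        (affine 1 (delta_mx 0 i) @^-1` F (r + 1)) x <-> F r x.
      by rewrite /F /L/= /affine scale1r !mxE !eqxx ltrD2r => ->.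
    apply/eqP; rewrite eq_le; apply/andP; split; apply: le_measure_ae => //.
      by apply: ae_imply wper => x /E[].
    by apply: ae_imply wper => x /E[].
  have Fn (k : nat) : mu (F k%:R) = mu (F 0) /\ mu (F (- k%:R)) = mu (F 0).
    elim: k => [|k [IH1 IH2]]; first by rewrite oppr0.
    rewrite -natr1 FS IH1 -IH2 -[X in _ /\ _ = mu (F X)](subrK 1) FS.
    by rewrite -opprD.
  have cL : mu (F k%:R) @[k --> \oo] --> mu (\bigcup_k F k%:R).
    apply: (@nondecreasing_cvg_mu _ _ _ mu) => //.
      by apply: bigcupT_measurable => k; exact: mF.
    move=> k l kl; rewrite subsetEset => x [Lx xk]; split => //=.
    by apply: lt_le_trans xk _; rewrite ler_nat.
  have c0 : mu (F (- k%:R)) @[k --> \oo] --> mu (\bigcap_k F (- k%:R)).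
    apply: (@nonincreasing_cvg_mu _ _ _ mu) => //.
    - apply: le_lt_trans (wfin _ alpha0); apply: le_measure; rewrite ?inE//.
      exact: subIsetl.
    - by apply: bigcapT_measurable => k; exact: mF.
    - move=> k l kl; rewrite subsetEset => x [Lx xk]; split => //=.
      by apply: lt_le_trans xk _; rewrite lerN2 ler_nat.
  have LE : L = \bigcup_k F k%:R.
    apply/seteqP; split => [x Lx|x [k _ []]//].
    near \oo => k; exists k => //; split => //=.
    by near: k; exact: nbhs_infty_gtr.
  have E0 : \bigcap_k F (- k%:R) = set0.
    apply/seteqP; split => // x h.
    near \oo => k; have [_ /=] := h k I; apply/negP; rewrite -leNgt lerNl.
    by apply: ltW; near: k; exact: nbhs_infty_gtr.
  rewrite LE.
  have -> : mu (\bigcup_k F k%:R) = mu (F 0).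
    apply: (cvg_unique _ cL) => //.
    by rewrite (_ : (fun k => _) = cst (mu (F 0)));
      [exact: cvg_cst|apply/funext => k; have [] := Fn k].
  transitivity (mu (\bigcap_k F (- k%:R))); last by rewrite E0 measure0.
  apply/esym; apply: (cvg_unique _ c0) => //.
  by rewrite (_ : (fun k => _) = cst (mu (F 0)));
    [exact: cvg_cst|apply/funext => k; have [] := Fn k].
have : {ae mu, forall x (k : nat), ~ (k.+1%:R^-1 < `|w x|)}.
  apply/ae_foralln => k; exists [set x | k.+1%:R^-1 < `|w x|]; split.
  - rewrite (_ : mkset _ = (fun x : T => `|w x|) @^-1` `]k.+1%:R^-1, +oo[).
      rewrite -[X in measurable X]setTI.
      exact: (measurableT_comp (@normr_measurable R setT) mw).
    by apply/seteqP; split => x /=; rewrite in_itv/= andbT.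
  - by apply: null; rewrite invr_gt0.
  - by move=> x /= /contrapT.
apply: ae_imply => x h; apply/eqP; rewrite -normr_eq0 eq_le normr_ge0 andbT.
rewrite leNgt; apply/negP => w0.
have [k _ /(_ k (leqnn k))] := near_infty_natSinv_lt (PosNum w0).
by apply/negP/negP => /=; exact: h.
Unshelve. all: by end_near. Qed.

Lemma weak_partialN i w d : weak_partial i w d ->
  weak_partial i (fun x => - w x) (fun x => - d x).
Proof.
move=> [lw ld h].
have lN f : locint f -> locint (fun x => - f x).
  move=> [mf intf]; split; first exact: measurableT_comp.
  by move=> a b; exact: (integrableN (intf a b)).
split; [exact: lN..|] => c a b chi c0 wchi.
have [K _ tchi] := tame_window c0 wchi.
have [L _ tdchi] := tame_window c0 (windows_derive_at i c0 wchi).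
have pN f psi M : locint f -> tame M a b psi ->
    pairing (fun x => - f x) psi = - pairing f psi.
  move=> lf tpsi; rewrite /pairing -mulN1r -RintegralZl//.
    by apply: eq_Rintegral => x _; rewrite mulN1r mulNr.
  exact: (integrable_pairing lf tpsi).
by rewrite (pN _ _ _ lw tdchi) (pN _ _ _ ld tchi) (h _ _ _ _ c0 wchi).
Qed.

(** Additivity of weak derivatives is an almost everywhere statement, because
the three derivatives are given separately. *)
Lemma weak_partialD_ae i w1 w2 w d1 d2 d : weak_partial i w d ->
  weak_partial i w1 d1 -> weak_partial i w2 d2 ->
  (forall x, w x = w1 x + w2 x) -> {ae mu, forall x, d x = d1 x + d2 x}.
Proof.
move=> [lw ld h] [lw1 ld1 h1] [lw2 ld2 h2] wE.
have lf : locint (fun x => d x - (d1 x + d2 x)).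
  split; first by apply: measurable_funB; [exact: ld.1|
    apply: measurable_funD; [exact: ld1.1|exact: ld2.1]].
  move=> a b; have mQ := measurable_obox a b.
  exact: (integrableB mQ (ld.2 a b) (integrableD mQ (ld1.2 a b) (ld2.2 a b))).
suff : {ae mu, forall x, d x - (d1 x + d2 x) = 0}.
  by apply: ae_imply => x /eqP; rewrite subr_eq0 => /eqP.
apply: fundamental_lemma => // c a b c0.
have wchi := @windows_bump1 _ _ c a b.
have [K _ tchi] := tame_window c0 wchi.
have [L _ tdchi] := tame_window c0 (windows_derive_at i c0 wchi).
have pD f g psi M : locint f -> locint g -> tame M a b psi ->
    pairing (fun x => f x + g x) psi = pairing f psi + pairing g psi.
  move=> lf' lg tpsi; rewrite /pairing -RintegralD//.
  - by apply: eq_Rintegral => x _; rewrite mulrDl.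
  - exact: (integrable_pairing lf' tpsi).
  - exact: (integrable_pairing lg tpsi).
have ld12 : locint (fun x => d1 x + d2 x).
  split; first by apply: measurable_funD; [exact: ld1.1|exact: ld2.1].
  move=> a' b'; have mQ := measurable_obox a' b'.
  exact: (integrableD mQ (ld1.2 a' b') (ld2.2 a' b')).
have e : pairing d (bump c a b) = pairing (fun x => d1 x + d2 x) (bump c a b).
  rewrite (pD _ _ _ _ ld1 ld2 tchi); apply: oppr_inj; rewrite opprD.
  rewrite -(h _ _ _ _ c0 wchi) -(h1 _ _ _ _ c0 wchi) -(h2 _ _ _ _ c0 wchi).
  rewrite -(pD _ _ _ _ lw1 lw2 tdchi); congr pairing; exact/funext.
transitivity (pairing d (bump c a b) - pairing (fun x => d1 x + d2 x) (bump c a b)).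
  rewrite /pairing -RintegralB//.
  - by apply: eq_Rintegral => x _; rewrite mulrBl.
  - exact: (integrable_pairing ld tchi).
  - exact: (integrable_pairing ld12 tchi).
by rewrite e subrr.
Qed.

Lemma dilateE s u : dilate s u = u \o affine s^-1 0.
Proof. by apply/funext => x; rewrite /dilate /= /affine addr0. Qed.

Lemma locint_dilate (s : R) (f : 'rV[R]_n -> R) : 0 < s -> locint f ->
  locint (dilate s f).
Proof.
move=> s0 [mf intf]; have s'0 : 0 < s^-1 by rewrite invr_gt0.
rewrite dilateE; split.
  exact: (measurableT_comp mf (measurable_affine 0 s'0)).
move=> a b.
have := integrable_affine 0 s'0 (measurable_obox (s^-1 *: a) (s^-1 *: b)) mf (intf _ _).
by rewrite preimage_affine_obox// invrK !subr0 !scalerA divff ?gt_eqF// !scale1r.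
Qed.

Lemma Rintegral_dilate s (h : 'rV[R]_n -> R) : 0 < s ->
  measurable_fun setT (h : T -> R) ->
  \int[mu]_x dilate s h x = s ^+ n * \int[mu]_x h x.
Proof.
move=> s0 mh; rewrite dilateE.
have s'0 : 0 < s^-1 by rewrite invr_gt0.
by rewrite (Rintegral_affine 0 s'0 mh) invrK.
Qed.

(** A bump seen at another scale is again a bump, so the change of variables
identifies the two weak derivatives when tested against bumps. *)
Lemma weak_partial_dilate_ae i s w d d' : 0 < s -> weak_partial i w d ->
  weak_partial i (dilate s w) d' ->
  {ae mu, forall x, d' x = s^-1 * dilate s d x}.
Proof.
move=> s0 [lw ld h] [lw' ld' h'].
have s1 : s != 0 by rewrite gt_eqF.
have lsd := locint_dilate s0 ld.
have lZ : locint (fun x => s^-1 * dilate s d x).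
  split; first exact: (measurable_funM (measurable_cst _) lsd.1).
  by move=> a b; exact: (integrableZl (measurable_obox a b) s^-1 (lsd.2 a b)).
have lf : locint (fun x => d' x - s^-1 * dilate s d x).
  split; first by apply: measurable_funB; [exact: ld'.1|exact: lZ.1].
  move=> a b; exact: (integrableB (measurable_obox a b) (ld'.2 a b) (lZ.2 a b)).
suff : {ae mu, forall x, d' x - s^-1 * dilate s d x = 0}.
  by apply: ae_imply => x /eqP; rewrite subr_eq0 => /eqP.
apply: fundamental_lemma => // c a b c0.
have wchi := @windows_bump1 _ _ c a b.
set chi := (fun i => bump1 c (a 0 i) (b 0 i)) in wchi.
have [K _ tchi] := tame_window c0 wchi.
have [L _ tdchi] := tame_window c0 (windows_derive_at i c0 wchi).
have sc0 : 0 < s^-1 * c by rewrite mulr_gt0// invr_gt0.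
have wchi' := @windows_bump1 _ _ (s^-1 * c) (s^-1 *: a) (s^-1 *: b).
set chi' := (fun i => bump1 _ _ _) in wchi'.
have chiE j r : chi' j r = chi j (s * r).
  by rewrite /chi' /chi bump1_scale// !mxE.
have [K' _ tchi'] := tame_window sc0 wchi'.
have [L' _ tdchi'] := tame_window sc0 (windows_derive_at i sc0 wchi').
have tE x : dilate s (tensor chi') x = tensor chi x.
  apply: eq_bigr => j _; rewrite chiE !mxE mulrA divff// mul1r//.
have dE x : dilate s (tensor (derive_at i chi')) x = s * tensor (derive_at i chi) x.
  rewrite /dilate /tensor (bigD1 i)//= [in RHS](bigD1 i)//= mulrA; congr (_ * _).
    rewrite /derive_at eqxx; have [dchi _] := window_derive c0 (wchi i).
    have -> : chi' i = chi i \o (fun r => s * r) by apply/funext => r; exact: chiE.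
    set r := (s^-1 *: x) 0 i.
    have rE : s * r = x 0 i by rewrite /r mxE mulrA divff// mul1r.
    have d1 : is_derive r 1 (fun r : R => s * r) s.
      have := @is_deriveZ _ _ _ (fun r : R => r) s r 1 _ (is_derive_id r 1).
      by rewrite /GRing.scale/= mulr1.
    have [_] := @is_derive1_comp _ (chi i) (fun r => s * r) r _ _
      (derivableP (dchi (s * r))) d1.
    by rewrite -derive1E => ->; rewrite -derive1E rE mulrC.
  apply: eq_bigr => j /negPf ji; rewrite /derive_at ji chiE.
  by rewrite !mxE mulrA divff// mul1r.
have pd f psi : locint f -> measurable_fun setT (psi : T -> R) ->
    pairing (dilate s f) (dilate s psi) = s ^+ n * pairing f psi.
  move=> lf' mpsi; apply: (@Rintegral_dilate s (fun x => f x * psi x) s0).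
  exact: (measurable_funM lf'.1 mpsi).
have e1 : pairing (dilate s w) (tensor (derive_at i chi)) =
    - (s^-1 * pairing (dilate s d) (tensor chi)).
  have -> : pairing (dilate s d) (tensor chi) = s ^+ n * pairing d (tensor chi').
    rewrite -pd//; last exact: tchi'.1.
    by congr pairing; apply/funext => x; rewrite tE.
  rewrite -(opprK (pairing d _)) -(h _ _ _ _ sc0 wchi') mulrN mulrN opprK.
  rewrite -pd//; last exact: tdchi'.1.
  rewrite (_ : dilate s (tensor _) = fun x => s * tensor (derive_at i chi) x);
    last exact/funext.
  rewrite /pairing -RintegralZl//.
    by apply: eq_Rintegral => x _; rewrite [RHS]mulrCA [s^-1 * (s * _)]mulrA mulVf// mul1r.
  have := integrableZl measurableT s (integrable_pairing (locint_dilate s0 lw) tdchi).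
  rewrite (_ : (fun x => _) = EFin \o
    (fun x => dilate s w x * (s * tensor (derive_at i chi) x)))//.
  by apply/funext => x; rewrite /= -EFinM mulrCA.
transitivity (pairing d' (tensor chi) - s^-1 * pairing (dilate s d) (tensor chi)).
  rewrite /pairing -RintegralZl//; last exact: (integrable_pairing lsd tchi).
  rewrite -RintegralB//.
  - by apply: eq_Rintegral => x _; rewrite mulrBl mulrA.
  - exact: (integrable_pairing ld' tchi).
  - exact: (integrableZl measurableT s^-1 (integrable_pairing lsd tchi)).
by rewrite -[pairing d' _]opprK -(h' _ _ _ _ c0 wchi) e1 opprK subrr.
Qed.

End vanish.

(** * Energy and potential *)

(** Write r^a = r r^(a - 1), where r^(a - 1) decreases in r. *)
Lemma powR_superadditive (R : realType) (a x y : R) : 0 < a < 1 ->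
  0 < x -> 0 < y -> (x + y) `^ a < x `^ a + y `^ a.
Proof.
move=> /andP[a0 a1] x0 y0; have xy0 : 0 < x + y by rewrite addr_gt0.
have dec z : 0 < z -> z < x + y -> (x + y) `^ (a - 1) < z `^ (a - 1).
  move=> z0 zxy; rewrite -opprB !powRN ltf_pV2 ?posrE ?powR_gt0//.
  by rewrite gt0_ltr_powR ?nnegrE ?ltW// subr_gt0.
rewrite -(mulr_powRB1 (ltW xy0) a0) -(mulr_powRB1 (ltW x0) a0).
rewrite -(mulr_powRB1 (ltW y0) a0) mulrDl ltrD// ltr_pM2l// dec//.
  by rewrite ltrDl.
by rewrite ltrDr.
Qed.

Section energy.
Context {R : realType} {n : nat}.

Notation mu := (@lebesgue_rV R n).
Notation T := (lebesgue_rVType R n).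
Implicit Types (u w : 'rV[R]_n -> R) (p s : R) (x y : 'rV[R]_n).

Lemma norm2Z s x : 0 <= s -> norm2 (s *: x) = s * norm2 x.
Proof.
move=> s0; rewrite /norm2 /dotv.
rewrite (_ : \sum_i _ = s ^+ 2 * \sum_i x 0 i * x 0 i).
  by rewrite sqrtrM ?sqr_ge0// sqrtr_sqr ger0_norm.
rewrite mulr_sumr; apply: eq_bigr => i _; rewrite !mxE expr2; ring.
Qed.

Lemma norm2_eq0 x : norm2 x = 0 -> forall i, x 0 i = 0.
Proof.
move=> /eqP; rewrite /norm2 sqrtr_eq0 => h i; apply/eqP.
rewrite -sqrf_eq0 eq_le sqr_ge0 andbT; apply: le_trans h.
rewrite /dotv (bigD1 i)//= expr2 lerDl sumr_ge0// => j _.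
by rewrite -expr2 sqr_ge0.
Qed.

Lemma ae_forall_ord (P : 'I_n -> 'rV[R]_n -> Prop) :
  (forall i, {ae mu, forall x, P i x}) -> {ae mu, forall x, forall i, P i x}.
Proof. exact: (@filter_forall _ _ P _ (ae_filter_ringOfSetsType mu)). Qed.

Lemma weak_gradientP u : weakly_differentiable u ->
  is_weak_gradient u (weak_gradient u).
Proof. exact: getPex. Qed.

Lemma L1_measurable (f : 'rV[R]_n -> R) : L1 f -> measurable_fun setT (f : T -> R).
Proof. by move=> /(measurable_int mu)/measurable_EFinP. Qed.

Lemma energy_ge0 p u : 0 < p -> 0 <= energy p u.
Proof.
move=> p0; rewrite /energy mulr_ge0 ?invr_ge0 ?(ltW p0)//.
by apply: Rintegral_ge0 => x _; exact: powR_ge0.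
Qed.

Lemma potential_dilate (G : R -> R) u s : 0 < s -> L1 (G \o u) ->
  potential G (dilate s u) = s ^+ n * potential G u.
Proof.
move=> s0 /L1_measurable mGu; exact: (@Rintegral_dilate _ _ s (G \o u) s0 mGu).
Qed.

(** Gradients scale by 1/s and integrals by s^n. *)
Lemma energy_dilate p u s : 0 < s -> weakly_differentiable u ->
  weakly_differentiable (dilate s u) ->
  L1 (fun x => norm2 (weak_gradient u x) `^ p) ->
  L1 (fun x => norm2 (weak_gradient (dilate s u) x) `^ p) ->
  energy p (dilate s u) = s ^+ n * s^-1 `^ p * energy p u.
Proof.
move=> s0 /weak_gradientP du /weak_gradientP dus Lu Lus.
set D := weak_gradient u in du Lu *.
set D' := weak_gradient (dilate s u) in dus Lus *.
have DD' : {ae mu, forall x, forall i, D' x 0 i = s^-1 * D (s^-1 *: x) 0 i}.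
  apply: ae_forall_ord => i.
  exact: (weak_partial_dilate_ae s0 (weak_gradient_partial i du)
    (weak_gradient_partial i dus)).
pose h x : R := norm2 (D x) `^ p.
have s'0 : 0 < s^-1 by rewrite invr_gt0.
have mh : measurable_fun setT (h : T -> R) := L1_measurable Lu.
have mdh : measurable_fun setT (dilate s h : T -> R).
  by rewrite dilateE; exact: (measurableT_comp mh (measurable_affine 0 s'0)).
rewrite /energy -/D' -/D; rewrite [RHS]mulrCA; congr (_ * _).
transitivity (\int[mu]_x (s^-1 `^ p * dilate s h x)).
  apply: eq_Rintegral_ae.
  - exact: (L1_measurable Lus).
  - exact: (measurable_funM (measurable_cst _) mdh).
  apply: ae_imply DD' => x e; rewrite /dilate /h -powRM ?sqrtr_ge0 ?ltW//.
  rewrite -norm2Z ?ltW//; congr (norm2 _ `^ _); apply/rowP => i.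
  by rewrite e mxE.
transitivity (\int[mu]_x dilate s (fun x => s^-1 `^ p * h x) x); first by [].
rewrite Rintegral_dilate//; last exact: (measurable_funM (measurable_cst _) mh).
by rewrite (RintegralZl _ measurableT Lu) mulrA.
Qed.

(** The gradient of a function of constant sign vanishes almost everywhere on
its zero set, so the gradients of the two parts are almost nowhere both
nonzero. *)
Lemma energy_split p u : 0 < p -> weakly_differentiable u ->
  weakly_differentiable (fun x => Num.max (u x) 0) ->
  weakly_differentiable (fun x => Num.min (u x) 0) ->
  L1 (fun x => norm2 (weak_gradient u x) `^ p) ->
  L1 (fun x => norm2 (weak_gradient (fun x => Num.max (u x) 0) x) `^ p) ->
  L1 (fun x => norm2 (weak_gradient (fun x => Num.min (u x) 0) x) `^ p) ->
  energy p u = energy p (fun x => Num.max (u x) 0) +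
               energy p (fun x => Num.min (u x) 0).
Proof.
set u1 := (fun x => Num.max (u x) 0); set u2 := (fun x => Num.min (u x) 0).
move=> p0 /weak_gradientP du /weak_gradientP du1 /weak_gradientP du2 Lu Lu1 Lu2.
rewrite /energy -mulrDr; congr (_ * _); rewrite -(RintegralD measurableT Lu1 Lu2).
move: (weak_gradient u) (weak_gradient u1) (weak_gradient u2) du du1 du2 Lu Lu1 Lu2.
move=> D D1 D2 du du1 du2 Lu Lu1 Lu2.
apply: eq_Rintegral_ae.
- exact: L1_measurable Lu.
- by apply: measurable_funD; [exact: L1_measurable Lu1|exact: L1_measurable Lu2].
have sum : {ae mu, forall x, forall i, D x 0 i = D1 x 0 i + D2 x 0 i}.
  apply: ae_forall_ord => i; apply: (weak_partialD_ae
    (weak_gradient_partial i du) (weak_gradient_partial i du1)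
    (weak_gradient_partial i du2)) => x.
  by rewrite /u1 /u2; case: (leP (u x) 0) => _; rewrite ?add0r ?addr0.
have z1 : {ae mu, forall x, forall i, u1 x = 0 -> D1 x 0 i = 0}.
  apply: ae_forall_ord => i.
  apply: (weak_partial_eq0 (weak_gradient_partial i du1)) => x.
  by rewrite /u1 le_max lexx orbT.
have z2 : {ae mu, forall x, forall i, u2 x = 0 -> D2 x 0 i = 0}.
  apply: ae_forall_ord => i.
  have := weak_partial_eq0 (weak_partialN (weak_gradient_partial i du2)).
  have h x : 0 <= - u2 x by rewrite /u2 oppr_ge0 ge_min lexx orbT.
  move=> /(_ h); apply: ae_imply => x e u20; apply: oppr_inj; rewrite oppr0.
  by apply: e; rewrite u20 oppr0.
have zero x : (forall i, x 0 i = 0) -> norm2 x `^ p = 0.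
  move=> x0; rewrite /norm2 /dotv big1 ?sqrtr0 ?powR0 ?gt_eqF// => i _.
  by rewrite x0 mul0r.
have z12 := ae_imply2 (fun x => @conj _ _) z1 z2.
apply: ae_imply2 sum z12 => x e [e1 e2].
have [u0|u0] := leP (u x) 0.
  rewrite (zero (D1 x)) ?add0r; last by move=> i; rewrite e1// /u1 max_r.
  by congr (norm2 _ `^ _); apply/rowP => i; rewrite e e1 ?add0r// /u1 max_r.
rewrite (zero (D2 x)) ?addr0; last by move=> i; rewrite e2// /u2 min_r// ltW.
by congr (norm2 _ `^ _); apply/rowP => i; rewrite e e2 ?addr0// /u2 min_r// ltW.
Qed.

(** The first partial derivative is zero, so u has period 1 in the first
coordinate. *)
Lemma energy0_ae_eq0 p u : (0 < n)%N -> 0 < p -> weakly_differentiable u ->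
  L1 (fun x => norm2 (weak_gradient u x) `^ p) ->
  (forall alpha : R, 0 < alpha -> (mu [set x | (alpha < `|u x|)%R] < +oo)%E) ->
  energy p u = 0 -> {ae mu, forall x, u x = 0}.
Proof.
move=> n0 p0 /weak_gradientP du Lu ufin /eqP.
rewrite /energy mulf_eq0 invr_eq0 gt_eqF//= => /eqP I0.
have D0 : {ae mu, forall x, weak_gradient u x 0 (Ordinal n0) = 0}.
  have := Rintegral_ge0_eq0_ae Lu (fun x => powR_ge0 _ _) I0.
  apply: ae_imply => x /powR_eq0_eq0 h; exact: (norm2_eq0 h).
have pu := weak_gradient_partial (Ordinal n0) du.
apply: (periodic_ae_eq0 (i := Ordinal n0)) => //; first by have [[]] := pu.
exact: (weak_partial0_translate pu D0).
Qed.

Lemma lebesgue_rV_setT : (0 < n)%N -> mu setT = +oo%E.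
Proof.
move=> n0.
have := @lebesgue_rV_box R n (fun=> setT) (fun=> measurableT).
rewrite (_ : mkset _ = setT); last by apply/seteqP; split.
move=> ->; have -> : lebesgue_measure [set: R] = +oo%E.
  by rewrite -set_itvNyy lebesgue_measure_itv.
case: n n0 => // m _; elim: m => [|m IH]; first by rewrite big_ord_recl big_ord0 mule1.
by rewrite big_ord_recl IH mulyy.
Qed.

Lemma cst_L1_eq0 (r : R) : (0 < n)%N -> L1 (cst r : 'rV[R]_n -> R) -> r = 0.
Proof.
move=> n0 /integrableP[_]; apply: contraPeq => r0.
apply/negP; rewrite -leNgt (_ : integral _ _ _ = +oo%E)//.
transitivity (\int[mu]_(x in setT) (`|r|%:E))%E; first by [].
rewrite (integral_cst mu measurableT) [X in (_ * X)%E]lebesgue_rV_setT//.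
by rewrite gt0_muley// lte_fin normr_gt0.
Qed.

End energy.

(** * Minimizers *)

Section minimizers.
Context {R : realType} {N : nat}.
Variables (p : R) (g G : R -> R) (X : set ('rV[R]_N -> R)).
Hypotheses (p_gt1 : 1 < p) (p_ltN : p < N%:R) (X_adm : admissible p g G X).

Notation mu := (@lebesgue_rV R N).

Let p_gt0 : 0 < p. Proof. exact: lt_trans p_gt1. Qed.

Let N_gt0 : (0 < N)%N.
Proof. by have := lt_trans p_gt0 p_ltN; rewrite ltr0n. Qed.

Let a : R := 1 - p / N%:R.

Let a01 : 0 < a < 1.
Proof.
have N0 : 0 < N%:R :> R by rewrite ltr0n.
rewrite subr_gt0 ltr_pdivrMr// mul1r p_ltN/= gtrBl.
by rewrite divr_gt0.
Qed.

(** Use the dilation of ratio m^(1/N): the energy scales by the power N - p of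
the ratio, hence by m^a. *)
Lemma dilate_scaling u m : X u -> 0 < m -> exists v,
  [/\ X v, potential G v = m * potential G u & energy p v = m `^ a * energy p u].
Proof.
move=> Xu m0; have N0 : (N%:R : R) != 0 by rewrite pnatr_eq0 -lt0n.
pose s := m `^ (N%:R^-1).
have s0 : 0 < s by exact: powR_gt0.
have sN : s ^+ N = m by rewrite -powR_mulrn ?ltW// -powRrM mulVf// powRr1// ltW.
have Xs := adm_dilate X_adm Xu s0.
exists (dilate s u); split => //.
  by rewrite (potential_dilate s0 (adm_potential X_adm Xu)) sN.
rewrite (energy_dilate s0 (adm_grad X_adm Xu) (adm_grad X_adm Xs)
  (adm_energy X_adm Xu) (adm_energy X_adm Xs)) sN; congr (_ * _).
have -> : s^-1 = m `^ (- N%:R^-1) by rewrite powRN.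
rewrite -powRrM; transitivity (m `^ 1 * m `^ (- N%:R^-1 * p)).
  by rewrite powRr1// ltW.
rewrite -powRD; last by rewrite (gt_eqF m0) implybT.
by congr (_ `^ _); rewrite /a; field.
Qed.

Hypothesis T_gt0 : (0 < infimum_energy p G X 1)%E.
Variable ustar : 'rV[R]_N -> R.
Hypothesis ustar_min : is_minimizer p G X 1 ustar.

Let Tmin := energy p ustar.

Let Tmin_gt0 : 0 < Tmin.
Proof.
have [Xs Vs _] := ustar_min; rewrite -lte_fin; apply: lt_le_trans T_gt0 _.
by apply: ereal_inf_lbound; exists ustar.
Qed.

(** Dilate v to a function of potential 1. *)
Lemma energy_lower_bound v : X v -> 0 < potential G v ->
  potential G v `^ a * Tmin <= energy p v.
Proof.
move=> Xv V0; have Vi0 : 0 < (potential G v)^-1 by rewrite invr_gt0.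
have [w [Xw Vw Jw]] := dilate_scaling Xv Vi0.
have Vw1 : potential G w = 1 by rewrite Vw mulVf// gt_eqF.
have [_ _ /(_ w Xw Vw1)] := ustar_min.
rewrite Jw; move: (energy p v) (potential G v) V0 => J m m0.
rewrite -(powR_inv1 (ltW m0)) -powRrM mulN1r powRN => h.
by rewrite -ler_pdivlMl// powR_gt0.
Qed.

(** Compare u with the dilate of ustar of potential lambda. *)
Lemma energy_minimizer lambda u : 0 < lambda -> is_minimizer p G X lambda u ->
  energy p u <= lambda `^ a * Tmin.
Proof.
move=> l0 [Xu Vu umin]; have [Xs Vs _] := ustar_min.
have [w [Xw Vw Jw]] := dilate_scaling Xs l0.
by rewrite -Jw; apply: umin => //; rewrite Vw Vs mulr1.
Qed.

(** G 0 is an integrable constant, and the space has infinite measure. *)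
Lemma admissible_G0 u : X u -> X (fun x => Num.max (u x) 0) ->
  X (fun x => Num.min (u x) 0) -> G 0 = 0.
Proof.
move=> Xu X1 X2; apply: (@cst_L1_eq0 R N) => //.
have := integrableB measurableT (integrableD measurableT
  (adm_potential X_adm X1) (adm_potential X_adm X2)) (adm_potential X_adm Xu).
rewrite /L1; suff <- : (fun x => (G (Num.max (u x) 0))%:E + (G (Num.min (u x) 0))%:E -
    (G (u x))%:E)%E = EFin \o cst (G 0) by [].
apply/funext => x; rewrite /= -!EFinD; congr EFin.
by case: (leP (u x) 0) => _; ring.
Qed.

Lemma potential_split u : X u -> X (fun x => Num.max (u x) 0) ->
  X (fun x => Num.min (u x) 0) ->
  potential G u = potential G (fun x => Num.max (u x) 0) +
                  potential G (fun x => Num.min (u x) 0).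
Proof.
move=> Xu X1 X2; have G0 := admissible_G0 Xu X1 X2.
rewrite /potential -(RintegralD measurableT (adm_potential X_adm X1)
  (adm_potential X_adm X2)); apply: eq_Rintegral => x _ /=.
by case: (leP (u x) 0) => _; rewrite G0 ?add0r ?addr0.
Qed.

(** If one part has nonpositive potential, the other part has potential at
least lambda and uses up the whole energy. *)
Lemma energy_part_le0 lambda (u1 u2 : 'rV[R]_N -> R) : 0 < lambda -> X u1 ->
  lambda <= potential G u1 ->
  energy p u1 + energy p u2 <= lambda `^ a * Tmin -> energy p u2 = 0.
Proof.
move=> l0 X1 lV h; apply/eqP; rewrite eq_le (energy_ge0 _ p_gt0) andbT.
have /andP[a0 _] := a01.
have := energy_lower_bound X1 (lt_le_trans l0 lV).
have : lambda `^ a * Tmin <= potential G u1 `^ a * Tmin.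
  rewrite (ler_pM2r Tmin_gt0); apply: (ge0_ler_powR (ltW a0)) => //.
    by rewrite nnegrE ltW.
  by rewrite nnegrE; exact: le_trans (ltW l0) lV.
move: h; move: (energy p u1) (energy p u2) => J1 J2.
by move: (_ * Tmin) (_ * Tmin) => A B; lra.
Qed.

(** If both parts had positive potential, the lower bounds on their energies
would add up to more than the energy of u. *)
Lemma minimizer_constant_sign lambda u : 0 < lambda ->
  is_minimizer p G X lambda u -> X (fun x => Num.max (u x) 0) ->
  X (fun x => Num.min (u x) 0) -> constant_sign u.
Proof.
move=> l0 umin X1 X2; have [Xu Vu _] := umin.
set u1 := (fun x => Num.max (u x) 0) in X1 *.
set u2 := (fun x => Num.min (u x) 0) in X2 *.
have Jle := energy_minimizer l0 umin.
have VE := potential_split Xu X1 X2; rewrite Vu -/u1 -/u2 in VE.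
have JE := energy_split p_gt0 (adm_grad X_adm Xu) (adm_grad X_adm X1)
  (adm_grad X_adm X2) (adm_energy X_adm Xu) (adm_energy X_adm X1)
  (adm_energy X_adm X2); rewrite -/u1 -/u2 in JE.
have vanish v : X v -> energy p v = 0 -> {ae mu, forall x, v x = 0}.
  move=> Xv; apply: energy0_ae_eq0 => //; first exact: (adm_grad X_adm).
    exact: (adm_energy X_adm).
  by move=> alpha; exact: (adm_vanish X_adm).
have [V2|V2] := leP (potential G u2) 0.
  left; have h1 : lambda <= potential G u1 by rewrite VE gerDl.
  have h2 : energy p u1 + energy p u2 <= lambda `^ a * energy p ustar.
    by rewrite -JE; exact: Jle.
  have := vanish _ X2 (energy_part_le0 l0 X1 h1 h2); apply: ae_imply => x.
  by rewrite /u2; case: (leP (u x) 0) => [_ ->|/ltW].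
have [V1|V1] := leP (potential G u1) 0.
  right; have h1 : lambda <= potential G u2 by rewrite VE gerDr.
  have h2 : energy p u2 + energy p u1 <= lambda `^ a * energy p ustar.
    by rewrite addrC -JE; exact: Jle.
  have := vanish _ X1 (energy_part_le0 l0 X2 h1 h2); apply: ae_imply => x.
  by rewrite /u1; case: (leP (u x) 0) => // + e; rewrite e ltxx.
have h := powR_superadditive a01 V1 V2.
rewrite -VE -(ltr_pM2r Tmin_gt0) mulrDl in h; rewrite JE in Jle.
have lb := lerD (energy_lower_bound X1 V1) (energy_lower_bound X2 V2).
by have := lt_le_trans h (le_trans lb Jle); rewrite ltxx.
Qed.

End minimizers.

Theorem proposition5 (R : realType) (N : nat) (p : R) (g G : R -> R)
    (X : set ('rV[R]_N -> R))
    (p_gt1 : 1 < p) (p_ltN : p < N%:R)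
    (g0 : g 0 = 0)
    (G_cont : continuous G)
    (G_C1 : forall s : R, s != 0 -> derivable G s 1 /\ {for s, continuous (derive1 G)})
    (gE : forall s : R, s != 0 -> g s = derive1 G s)
    (X_adm : admissible p g G X)
    (X_min : forall u (t : R), X u -> 0 <= t -> X (fun x => Num.min (u x) t))
    (X_max : forall u (s : R), X u -> s <= 0 -> X (fun x => Num.max (u x) s))
    (T_gt0 : (0 < infimum_energy p G X 1)%E)
    (T_attained : exists ustar, is_minimizer p G X 1 ustar)
    (lambda : R) (lambda_gt0 : 0 < lambda)
    (u : 'rV[R]_N -> R) (u_min : is_minimizer p G X lambda u) :
  constant_sign u.
Proof.
have [ustar ustar_min] := T_attained; have [Xu _ _] := u_min.
exact: (minimizer_constant_sign p_gt1 p_ltN X_adm T_gt0 ustar_min lambda_gt0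
  u_min (X_max _ _ Xu (lexx 0)) (X_min _ _ Xu (lexx 0))).
Qed.
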